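(* Let $\tau\in\mathbb R^r\setminus\{0\}$ be such that $B^\tau$ is non-degenerate. For all $\mathbf k,\mathbf p,\mathbf q,\mathbf m\in\mathbb Z_+^n$, $$\widetilde{\mathscr L}_{(\mathbf k\wedge\mathbf p)-\mathbf 1}^{(\mathbf p-\mathbf k)}(\cdot,\tau)*_\tau\widetilde{\mathscr L}_{(\mathbf q\wedge\mathbf m)-\mathbf 1}^{(\mathbf q-\mathbf m)}(\cdot,\tau)=\delta_{\mathbf k}^{(\mathbf q)}\,\widetilde{\mathscr L}_{(\mathbf p\wedge\mathbf m)-\mathbf 1}^{(\mathbf p-\mathbf m)}(\cdot,\tau),$$ where $\mathbf p\wedge\mathbf m-\mathbf 1:=(\min(p_1,m_1)-1,\dots,\min(p_n,m_n)-1)$ and $\delta_{\mathbf k}^{(\mathbf q)}$ is the Kronecker delta ($1$ if $\mathbf k=\mathbf q$ and $0$ otherwise).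
   Context: $\mathbb Z_+=\{1,2,\dots\}$. Let $n,r\ge1$ and $B^1,\dots,B^r$ real skew-symmetric $2n\times 2n$ matrices; for $\tau\in\mathbb R^r$ let $B^\tau=\sum_\beta\tau_\beta B^\beta$, regarded also as the bilinear form $B^\tau(x,y)=x^tB^\tau y$ on $\mathbb R^{2n}$. The twisted convolution is $f*_\tau g(y)=\int_{\mathbb R^{2n}}e^{-2iB^\tau(y,x)}f(y-x)g(x)\,dx$. For $\tau\neq0$ with $B^\tau$ non-degenerate put $\dot\tau=\tau/|\tau|$ and fix an orthonormal basis $v_1^\tau,\dots,v_{2n}^\tau$ of $\mathbb R^{2n}$ (depending only on $\dot\tau$) normalizing $B^\tau$: $-B^\tau(v^\tau_{2j-1},v^\tau_{2j})=B^\tau(v^\tau_{2j},v^\tau_{2j-1})=\mu_j(\tau)$, $j=1,\dots,n$, and $B^\tau(v^\tau_k,v^\tau_l)=0$ for all other pairs, with $\mu_1(\tau)\ge\dots\ge\mu_n(\tau)>0$; thus $\mu_j(\tau)=|\tau|\mu_j(\dot\tau)$. Write $y=\sum_k y_k^\tau v_k^\tau$ ($\tau$-coordinates) and $\mathbf y_j^\tau=(y_{2j-1}^\tau,y_{2j}^\tau)\in\mathbb R^2$. For $k,p\in\mathbb Z_{\ge0}$, $\sigma\ge 0$, let $l_k^{(p)}(\sigma)=\left[\frac{\Gamma(k+1)}{\Gamma(k+p+1)}\right]^{1/2}L_k^{(p)}(\sigma)\sigma^{p/2}e^{-\sigma/2}$, where the generalized Laguerre polynomials are given by $\sum_{k\ge0}L_k^{(p)}(\sigma)z^k=(1-z)^{-p-1}e^{-\sigma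 z/(1-z)}$, $|z|<1$. For $p\in\mathbb Z$, $k\in\mathbb Z_{\ge0}$ and $x=x_1+ix_2=|x|e^{i\theta}\in\mathbb R^2$ let $$\widetilde{\mathscr L}_k^{(p)}(x,\tau)=\frac{2|\tau|}{\pi}(\mathrm{sgn}\,p)^p\,l_k^{(|p|)}(2|\tau||x|^2)e^{ip\theta}$$ (with $(\mathrm{sgn}\,0)^0=1$). For $\mathbf p\in\mathbb Z^n$, $\mathbf k\in\mathbb Z_{\ge0}^n$, the exponential Laguerre functions on $\mathbb R^{2n}$ are $$\widetilde{\mathscr L}_{\mathbf k}^{(\mathbf p)}(y,\tau)=\prod_{j=1}^n\mu_j(\dot\tau)\,\widetilde{\mathscr L}_{k_j}^{(p_j)}\big(\sqrt{\mu_j(\dot\tau)}\,\mathbf y_j^\tau,\tau\big).$$ *)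

(* Defs.v *)
From HB Require Import structures.
From mathcomp Require Import all_boot all_order all_algebra.
From mathcomp Require Import complex.
From mathcomp Require Import all_classical all_reals all_analysis.

Set Implicit Arguments.
Unset Strict Implicit.
Unset Printing Implicit Defensive.

Import Order.TTheory GRing.Theory Num.Theory.
Import numFieldNormedType.Exports.

Local Open Scope classical_set_scope.
Local Open Scope complex_scope.
Local Open Scope ring_scope.

Section LebesgueCons.
Context {R : realType} {d : nat}.
Let T := measurableTypeR R.
Variable m : {sigma_finite_measure set (d.-tuple T) -> \bar R}.

Definition tuple_cons (p : T * d.-tuple T) : d.+1.-tuple T :=
  [the d.+1.-tuple T of p.1 :: p.2].

Lemma measurable_tuple_cons : measurable_fun [set: _] tuple_cons.
Proof. exact: measurable_cons measurable_fst measurable_snd. Qed.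

(* The image of lebesgue_measure x m under (x, t) |-> x :: t. *)
Definition lebesgue_cons : set (d.+1.-tuple T) -> \bar R :=
  pushforward (product_measure1 (@lebesgue_measure R) m) tuple_cons.

Let mtc A : measurable A -> measurable (tuple_cons @^-1` A).
Proof.
by move=> mA; rewrite -[X in measurable X]setTI; apply: measurable_tuple_cons.
Qed.

Let lebesgue_cons0 : lebesgue_cons set0 = 0%E.
Proof. by rewrite /lebesgue_cons /pushforward preimage_set0 measure0. Qed.

Let lebesgue_cons_ge0 A : (0 <= lebesgue_cons A)%E.
Proof. by rewrite /lebesgue_cons /pushforward; exact: measure_ge0. Qed.

Let lebesgue_cons_sigma_additive : semi_sigma_additive lebesgue_cons.
Proof.
move=> F mF tF mUF; rewrite /lebesgue_cons /pushforward preimage_bigcup.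
apply: measure_semi_sigma_additive.
- by move=> i; exact: mtc.
- apply/trivIsetP => /= i j _ _ ij; rewrite -preimage_setI.
  by move/trivIsetP : tF => /(_ _ _ _ _ ij) ->//; rewrite preimage_set0.
- by rewrite -preimage_bigcup; exact: mtc.
Qed.

HB.instance Definition _ := isMeasure.Build _ _ _ lebesgue_cons
  lebesgue_cons0 lebesgue_cons_ge0 lebesgue_cons_sigma_additive.

Let lebesgue_cons_sigma_finite : sigma_finite [set: d.+1.-tuple T] lebesgue_cons.
Proof.
have /sigma_finiteP[F [TF ndF Foo]] := sigma_finiteT (@lebesgue_measure R).
have /sigma_finiteP[G [TG ndG Goo]] := sigma_finiteT m.
pose g (t : d.+1.-tuple T) : T * d.-tuple T := (thead t, [tuple of behead t]).
have mg : measurable_fun [set: _] g.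
  apply/measurable_fun_pairP; split; first exact: measurable_tnth.
  exact: measurable_behead.
have gK : cancel tuple_cons g.
  by move=> [x t]; rewrite /g /tuple_cons theadE; congr (_, _); exact/val_inj.
exists (fun i => g @^-1` (F i `*` G i)).
  apply/esym/seteqP; split => // t _.
  have [i _ Fi] : (\bigcup_i F i) (g t).1 by rewrite -TF.
  have [j _ Gj] : (\bigcup_i G i) (g t).2 by rewrite -TG.
  exists (maxn i j) => //; split.
    by move: Fi; exact/subsetPset/ndF/leq_maxl.
  by move: Gj; exact/subsetPset/ndG/leq_maxr.
move=> i; have [mFi Fioo] := Foo i; have [mGi Gioo] := Goo i; split.
  rewrite -[X in measurable X]setTI; apply: mg => //; exact: measurableX.
rewrite /lebesgue_cons /pushforward -comp_preimage.
rewrite (_ : _ \o _ = id) ?preimage_id; last first.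
  by apply/funext => p; rewrite /= gK.
by rewrite product_measure1E// lte_mul_pinfty// ge0_fin_numE.
Qed.

HB.instance Definition _ := Measure_isSigmaFinite.Build _ _ _ lebesgue_cons
  lebesgue_cons_sigma_finite.

End LebesgueCons.

Section LebesgueTuple.
Context {R : realType}.
Let T := measurableTypeR R.

(* Lebesgue measure on R^d: the d-fold product of the Lebesgue measure of R. *)
Fixpoint lebesgue_tuple (d : nat) :
    {sigma_finite_measure set (d.-tuple T) -> \bar R} :=
  match d with
  | 0 => [the {sigma_finite_measure set (0.-tuple T) -> \bar R}
            of dirac [tuple]]
  | d'.+1 => [the {sigma_finite_measure set (d'.+1.-tuple T) -> \bar R}
            of lebesgue_cons (lebesgue_tuple d')]
  end.

Lemma lebesgue_tuple_box d (A : 'I_d -> set T) :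
    (forall i, measurable (A i)) ->
  lebesgue_tuple d [set t | forall i, A i (tnth t i)] =
  (\prod_(i < d) lebesgue_measure (A i))%E.
Proof.
elim: d A => [A _|d IH A mA] /=.
  rewrite big_ord0 diracE mem_set//=; by case.
rewrite big_ord_recl -IH; last by move=> i; exact: mA.
rewrite -product_measure1E//; last first.
  rewrite [X in measurable X](_ : _ =
     \bigcap_(i in [set: 'I_d]) ((fun t => tnth t i) @^-1` A (lift ord0 i))).
    apply: fin_bigcap_measurable; first exact: finite_finset.
    move=> i _; rewrite -[X in measurable X]setTI.
    by apply: measurable_tnth => //; exact: mA.
  by apply/seteqP; split => t /= h i; [move=> _; exact: h|exact: h].
rewrite /lebesgue_cons /pushforward; congr (product_measure1 _ _ _).
apply/seteqP; split => -[x t] /=.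
  move=> h; split; first exact: (h ord0).
  by move=> i; have := h (lift ord0 i); rewrite tnthS.
move=> [hx ht] i; case: (unliftP ord0 i) => [j|] ->; last exact: hx.
rewrite tnthS; exact: ht.
Qed.

End LebesgueTuple.

(* The integral over R^d of a complex-valued function. *)
Definition cintegral (R : realType) d (f : 'cV[R]_d -> R[i]) : R[i] :=
  (\int[lebesgue_tuple d]_t complex.Re (f (\col_k tnth t k))) +i*
  (\int[lebesgue_tuple d]_t complex.Im (f (\col_k tnth t k))).

Section TwistedConvolution.
Context {R : realType} {r n : nat}.
Implicit Types (B : 'I_r -> 'M[R]_(n.*2)) (tau : 'cV[R]_r).
Implicit Types (A V : 'M[R]_(n.*2)) (x y : 'cV[R]_(n.*2)).

Definition expi (t : R) : R[i] := cos t +i* sin t.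

Definition enorm d (x : 'cV[R]_d) : R := Num.sqrt (\sum_k x k 0 ^+ 2).

Definition udir tau : 'cV[R]_r := (enorm tau)^-1 *: tau.

Definition pencil B tau : 'M[R]_(n.*2) := \sum_b tau b 0 *: B b.

Definition bform A x y : R := (x^T *m A *m y) 0 0.

Definition twisted_conv B tau (f g : 'cV[R]_(n.*2) -> R[i]) y : R[i] :=
  cintegral (fun x => expi (- 2 * bform (pencil B tau) y x) * f (y - x) * g x).

(* With indices counted from 0, the j-th pair (v_{2j-1}, v_{2j}) sits at
   positions 2j and 2j+1. *)
Definition fst_idx (j : 'I_n) : 'I_(n.*2) :=
  Ordinal (etrans (ltn_double j n) (ltn_ord j)).
Definition snd_idx (j : 'I_n) : 'I_(n.*2) :=
  Ordinal (etrans (ltn_Sdouble j n) (ltn_ord j)).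

(* mu is determined by A and V: it is the value in normalizes_snd_fst.
   The columns of V form an orthonormal basis that normalizes A. *)
Record normalizes A V (mu : 'I_n -> R) : Prop := {
  normalizes_orthonormal : V^T *m V = 1%:M ;
  normalizes_fst_snd : forall j,
    - bform A (col (fst_idx j) V) (col (snd_idx j) V) = mu j ;
  normalizes_snd_fst : forall j,
    bform A (col (snd_idx j) V) (col (fst_idx j) V) = mu j ;
  normalizes_other : forall k l,
    (forall j, (k, l) <> (fst_idx j, snd_idx j) /\
               (k, l) <> (snd_idx j, fst_idx j)) ->
    bform A (col k V) (col l V) = 0 ;
  normalizes_pos : forall j, 0 < mu j ;
  normalizes_decr : forall i j : 'I_n, (i <= j)%N -> mu j <= mu i }.

(* tau |-> (v^tau, mu(tau)) is a choice of normalizing bases for all the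
   admissible tau; v^tau depends on the direction of tau only. *)
Definition normalizing_choice B (v : 'cV[R]_r -> 'M[R]_(n.*2))
    (mu : 'cV[R]_r -> 'I_n -> R) : Prop :=
  forall tau, tau != 0 -> pencil B tau \in unitmx ->
    normalizes (pencil B tau) (v tau) (mu tau) /\ v tau = v (udir tau).

(* The j-th pair of tau-coordinates of y, where y = V *m (coordinates),
   viewed as a complex number. *)
Definition coord_pair V y (j : 'I_n) : R[i] :=
  let c := invmx V *m y in c (fst_idx j) 0 +i* c (snd_idx j) 0.

End TwistedConvolution.

Section Laguerre.
Context {R : realType}.

(* a is the sequence of coefficients of the generating function
   (1 - z)^(-p-1) exp(- s z / (1 - z)) of the polynomials L_k^(p)(s); such a
   sequence exists and the identity for real z determines it. *)
Definition laguerre_generating (p : nat) (s : R) (a : nat -> R) : Prop :=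
  forall z : R, `|z| < 1 ->
    series (fun k => a k * z ^+ k) @ \oo -->
      (1 - z) ^- p.+1 * expR (- (s * z / (1 - z))).

Definition laguerre (k p : nat) (s : R) : R :=
  xget (fun=> 0) [set a | laguerre_generating p s a] k.

(* Gamma (k + 1) = k! and Gamma (k + p + 1) = (k + p)!. *)
Definition laguerre_fun (k p : nat) (s : R) : R :=
  Num.sqrt ((k`!)%:R / ((k + p)`!)%:R) * laguerre k p s *
  s `^ (p%:R / 2) * expR (- (s / 2)).

(* e^(i theta) = x / |x| when x != 0; at x = 0 the value is immaterial for
   p != 0 because laguerre_fun k `|p| 0 = 0, and 0 ^ 0 = 1 for p = 0.
   The integer power (sgz p) ^ p equals 1 for p = 0.
   `|x| : R[i] has zero imaginary part; nx is the real modulus. *)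
Definition exp_laguerre1 r (k : nat) (p : int) (x : R[i]) (tau : 'cV[R]_r) :
    R[i] :=
  let nx := complex.Re `|x| in
  (2 * enorm tau / pi)%:C * ((sgz p) ^ p)%:~R *
  (laguerre_fun k `|p| (2 * enorm tau * nx ^+ 2))%:C * (x / `|x|) ^ p.

Definition exp_laguerre r n (v : 'cV[R]_r -> 'M[R]_(n.*2))
    (mu : 'cV[R]_r -> 'I_n -> R) (k : 'I_n -> nat) (p : 'I_n -> int)
    (y : 'cV[R]_(n.*2)) (tau : 'cV[R]_r) : R[i] :=
  \prod_j ((mu (udir tau) j)%:C *
    exp_laguerre1 (k j) (p j)
      ((Num.sqrt (mu (udir tau) j))%:C * coord_pair (v tau) y j) tau).

End Laguerre.

(* Main.v *)
Require Import Defs.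
From HB Require Import structures.
From mathcomp Require Import all_boot all_order all_algebra.
From mathcomp Require Import complex ring lra.
From mathcomp Require Import all_classical all_reals all_analysis.
From mathcomp Require Import measurable_realfun lebesgue_integral_under.

Set Implicit Arguments.
Unset Strict Implicit.
Unset Printing Implicit Defensive.

Import Order.TTheory GRing.Theory Num.Theory.
Import numFieldNormedType.Exports.

Local Open Scope classical_set_scope.
Local Open Scope complex_scope.
Local Open Scope ring_scope.


(** Write T for the norm of tau and mu_j for the values attached to its direction. In
    the scaled coordinates u_j = sqrt (2 T mu_j) y_j, where the j-th pair of adapted
    coordinates y_j is read as a complex number, everything splits over the pairs. The
    oscillating factor of the twisted convolution becomes the product of the
    exp (i Im (conj u_j w_j)), and an exponential Laguerre function becomes, up to the
    factors 2 T mu_j / pi, a product of the functions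
      g_ab (u) = exp (- |u|^2 / 2) H_ab (u, - conj u) / sqrt (a! b!)
    of one complex variable, where H_ab is the complex Hermite (Ito) polynomial, the
    coefficient of s^a t^b / (a! b!) in exp (s t + s U + t V): the upper index of the
    Laguerre function is the difference a - b and the lower one is the minimum of a
    and b, so both families are the same, indexed by pairs ([exp_laguerre1E]). This
    rests on the closed form of the Laguerre polynomials ([laguerreE]).

    In one variable the claim is that the g_ab multiply like matrix units: the twisted
    convolution of g_ab and g_cd is pi g_ad if b = c and 0 otherwise
    ([has_cint_hermite_fun]). Collecting exponents, the integrand is
    exp (- |u|^2 / 2) times exp (conj u w - |w|^2) times a product of two Hermite
    polynomials. Against that Gaussian, multiplication by w is the derivative in
    conj w, and multiplication by conj w is the derivative in w plus multiplication by
    conj u ([gint_mul_id], [gint_mul_conj]), while the total mass is pi whatever u is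
    ([gint_cst1]). The recurrences of the Hermite polynomials then trade raising b for
    lowering c, which produces the Kronecker delta and the factor b!, and rebuild H_ad
    when b = c = 0 ([twisted_momentE]).

    The passage from R^(2n) to the n planes is a linear change of variables
    ([unitmx_scales_volume]) followed by Fubini ([has_cint_prod_pairs]). The Jacobian
    contributes 1 / (2 T mu_j) for each pair, and 1 / (2 T mu_j) times pi times
    (2 T mu_j / pi)^2 is again 2 T mu_j / pi, the constant of the product. *)

(** * Linear changes of variables for Lebesgue measure *)

Section LinearChangeOfVariables.
Context {R : realType}.
Local Notation T := (measurableTypeR R).
Local Notation lam := (@lebesgue_measure R).

Lemma lebesgue_measure_affine (a b : R) (A : set T) : a != 0 -> measurable A ->
  (`|a|%:E * lam ((fun x : T => (a * x + b)%R : T) @^-1` A) = lam A)%E.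
Proof.
move=> a0 mA.
have mf : measurable_fun [set: T] (fun x : T => a * x + b : T).
  by apply: measurable_funD => //; exact: measurable_funM.
pose mu_ : {measure set T -> \bar R} :=
  mscale (NngNum (normr_ge0 a)) (pushforward lam (fun x : T => a * x + b : T)).
pose mu := mu_ mf.
apply/esym; move: A mA.
apply: (lebesgue_measure_unique (mu := mu)) => _ [[x y] _ <-] /=.
rewrite /mu /mu_ /mscale /= /pushforward.
have [a1|a1] := ltP 0 a.
  rewrite (_ : _ @^-1` _ = `](x - b) / a, (y - b) / a]%classic); last first.
    apply/seteqP; split => z /=; rewrite !in_itv /=.
      by rewrite ltr_pdivrMr// ler_pdivlMr// ltrBlDr lerBrDr mulrC.
    by rewrite ltr_pdivrMr// ler_pdivlMr// ltrBlDr lerBrDr mulrC.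
  rewrite !lebesgue_measure_itv /= !lte_fin ltr_pM2r ?invr_gt0// ltrD2r.
  case: ifP => _; last by rewrite mule0.
  by rewrite -!EFinB -EFinM gtr0_norm//; congr EFin; field.
have {}a1 : a < 0 by rewrite lt_neqAle a0.
rewrite (_ : _ @^-1` _ = `[(y - b) / a, (x - b) / a[%classic); last first.
  apply/seteqP; split => z /=; rewrite !in_itv /=.
    by rewrite ltr_ndivlMr// ler_ndivrMr// ltrBlDr lerBrDr mulrC andbC.
  by rewrite ltr_ndivlMr// ler_ndivrMr// ltrBlDr lerBrDr mulrC andbC.
rewrite !lebesgue_measure_itv /= !lte_fin ltr_nM2r ?invr_lt0// ltrD2r.
case: ifP => _; last by rewrite mule0.
by rewrite -!EFinB -EFinM ltr0_norm//; congr EFin; field.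
Qed.

Lemma ge0_integral_affine (a b : R) (f : T -> \bar R) : a != 0 ->
  measurable_fun [set: T] f -> (forall x, (0 <= f x)%E) ->
  (`|a|%:E * \int[lam]_x f (a * x + b)%R = \int[lam]_x f x)%E.
Proof.
move=> a0 mf f0.
have ma : measurable_fun [set: T] (fun x : T => a * x + b : T).
  by apply: measurable_funD => //; exact: measurable_funM.
pose mu_ : {measure set T -> \bar R} :=
  pushforward lam (fun x : T => a * x + b : T).
pose mu := mu_ ma.
rewrite -[X in (_ * X)%E](_ : (\int[mu]_x f x = _)%E); last first.
  by rewrite ge0_integral_pushforward.
rewrite -(ge0_integral_mscale mu measurableT (NngNum (normr_ge0 a)))//.
by apply: eq_measure_integral => A mA _; exact: lebesgue_measure_affine.
Qed.

Definition mxaff d (A : 'M[R]_d) (b : 'cV[R]_d) (t : d.-tuple T) : d.-tuple T :=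
  [tuple (A *m (\col_k tnth t k) + b) i 0 : T | i < d].

Lemma measurable_mxaff d (A : 'M[R]_d) b : measurable_fun [set: _] (mxaff A b).
Proof.
apply/measurable_fun_tnthP => i.
rewrite (_ : _ \o _ = fun t => \sum_k (A i k * tnth t k) + b i 0); last first.
  apply/funext => t /=; rewrite tnth_mktuple !mxE; congr (_ + _).
  by apply: eq_bigr => k _; rewrite mxE.
apply: measurable_funD => //; apply: measurable_sum => k.
by apply: measurable_funM => //; exact: measurable_tnth.
Qed.

Lemma mxaff_comp d (A A' : 'M[R]_d) b b' t :
  mxaff A b (mxaff A' b' t) = mxaff (A *m A') (A *m b' + b) t.
Proof.
apply: eq_from_tnth => i; rewrite !tnth_mktuple; congr (_ i 0).
rewrite addrA -mulmxA -mulmxDr; congr (A *m _ + _).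
by apply/matrixP => j k; rewrite ord1 mxE tnth_mktuple.
Qed.

Lemma mxaff1 d (t : d.-tuple T) : mxaff 1%:M 0 t = t.
Proof.
by apply: eq_from_tnth => i; rewrite tnth_mktuple mul1mx addr0 mxE.
Qed.

(** Translations are included because, in an induction on the dimension, the sections
    of a linear image are affine images. *)
Definition scales_volume d (A : 'M[R]_d) := forall b S, measurable S ->
  (`|\det A|%:E * lebesgue_tuple d (mxaff A b @^-1` S) = lebesgue_tuple d S)%E.

Lemma scales_volumeM d (A A' : 'M[R]_d) :
  scales_volume A -> scales_volume A' -> scales_volume (A *m A').
Proof.
move=> hA hA' b S mS.
have -> : mxaff (A *m A') b @^-1` S = mxaff A' 0 @^-1` (mxaff A b @^-1` S).
  by apply/seteqP; split => t /=; rewrite mxaff_comp mulmx0 add0r.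
rewrite det_mulmx normrM EFinM -muleA hA'//.
  exact: hA.
by rewrite -[X in measurable X]setTI; exact: measurable_mxaff.
Qed.

Lemma measurable_tuple_cons_xsection d (S : set (d.+1.-tuple T)) (x : T) :
  measurable S -> measurable [set t | S (tuple_cons (x, t))].
Proof.
move=> mS.
rewrite (_ : [set t | _] = xsection (@tuple_cons R d @^-1` S) x); last first.
  by apply/seteqP; split => t /=; rewrite /xsection /= in_setE.
apply: measurable_xsection; rewrite -[X in measurable X]setTI.
exact: measurable_tuple_cons.
Qed.

Lemma measurable_tuple_cons_ysection d (S : set (d.+1.-tuple T)) (t : d.-tuple T) :
  measurable S -> measurable [set x : T | S (tuple_cons (x, t))].
Proof.
move=> mS.
rewrite (_ : [set x | _] = ysection (@tuple_cons R d @^-1` S) t); last first.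
  by apply/seteqP; split => x /=; rewrite /ysection /= in_setE.
apply: measurable_ysection; rewrite -[X in measurable X]setTI.
exact: measurable_tuple_cons.
Qed.

Lemma lebesgue_tuple_xsection d (S : set (d.+1.-tuple T)) :
  lebesgue_tuple d.+1 S =
  (\int[lam]_x lebesgue_tuple d [set t | S (tuple_cons (x, t))])%E.
Proof.
rewrite /= /lebesgue_cons /pushforward /product_measure1 /=.
apply: eq_integral => x _; congr (lebesgue_tuple d _).
by apply/seteqP; split => t /=; rewrite /xsection /= in_setE.
Qed.

Lemma lebesgue_tuple_ysection d (S : set (d.+1.-tuple T)) : measurable S ->
  lebesgue_tuple d.+1 S =
  (\int[lebesgue_tuple d]_t lam [set x | S (tuple_cons (x, t))])%E.
Proof.
move=> mS.
have mS' : measurable (@tuple_cons R d @^-1` S).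
  by rewrite -[X in measurable X]setTI; exact: measurable_tuple_cons.
rewrite /= /lebesgue_cons /pushforward.
rewrite (product_measure_unique (m' := product_measure2 lam (lebesgue_tuple d)))//.
  rewrite /= /product_measure2; apply: eq_integral => t _; congr (lam _).
  by apply/seteqP; split => x /=; rewrite /ysection /= in_setE.
by move=> A B mA mB; exact: product_measure2E.
Qed.

Lemma col_tuple_cons d (x : T) (t : d.-tuple T) :
  (\col_k tnth (tuple_cons (x, t)) k : 'cV[R]_(1 + d)) =
  col_mx x%:M (\col_k tnth t k).
Proof.
apply/matrixP => i j; rewrite mxE ord1.
case: (splitP i) => [k ik|k ik].
  have -> : i = lshift d k by exact/val_inj.
  by rewrite col_mxEu mxE ord1 !eqxx.
have -> : i = rshift 1 k by exact/val_inj.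
by rewrite col_mxEd mxE -[RHS](tnthS x t); congr tnth; exact/val_inj.
Qed.

Lemma mxaff_lblock d (a : R) (c : 'cV[R]_d) (L : 'M[R]_d) (b : 'cV[R]_(1 + d))
    (x : T) (t : d.-tuple T) :
  mxaff (block_mx a%:M 0 c L) b (tuple_cons (x, t)) =
  tuple_cons (a * x + b 0 0, mxaff L (x *: c + dsubmx b) t).
Proof.
apply: eq_from_tnth => i.
rewrite tnth_mktuple col_tuple_cons mul_block_col mul0mx addr0.
rewrite -scalar_mxM -[b in LHS]vsubmxK add_col_mx.
case: (unliftP ord0 i) => [k|] ->.
  rewrite tnthS tnth_mktuple (_ : lift ord0 k = rshift 1 k); last exact/val_inj.
  by rewrite col_mxEd mul_mx_scalar addrCA addrA.
transitivity (col_mx ((a * x)%:M + usubmx b)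
    (c *m x%:M + L *m \col_k tnth t k + dsubmx b) (lshift d 0) 0).
  by congr (col_mx _ _ _ _); exact/val_inj.
rewrite col_mxEu !mxE eqxx mulr1n /=; congr (_ + b _ _); exact/val_inj.
Qed.

Lemma mxaff_ublock d (a : R) (c : 'rV[R]_d) (U : 'M[R]_d) (b : 'cV[R]_(1 + d))
    (x : T) (t : d.-tuple T) :
  mxaff (block_mx a%:M c 0 U) b (tuple_cons (x, t)) =
  tuple_cons (a * x + ((c *m \col_k tnth t k) 0 0 + b 0 0),
              mxaff U (dsubmx b) t).
Proof.
apply: eq_from_tnth => i.
rewrite tnth_mktuple col_tuple_cons mul_block_col mul0mx add0r.
rewrite -scalar_mxM -[b in LHS]vsubmxK add_col_mx.
case: (unliftP ord0 i) => [k|] ->.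
  rewrite tnthS tnth_mktuple (_ : lift ord0 k = rshift 1 k); last exact/val_inj.
  by rewrite col_mxEd.
transitivity (col_mx ((a * x)%:M + c *m (\col_k tnth t k) + usubmx b)
    (U *m \col_k tnth t k + dsubmx b) (lshift d 0) 0).
  by congr (col_mx _ _ _ _); exact/val_inj.
rewrite col_mxEu !mxE eqxx mulr1n /= addrA; congr (_ + b _ _); exact/val_inj.
Qed.

Lemma measurable_fun_lebesgue_xsection d (S : set (d.+1.-tuple T)) :
  measurable S ->
  measurable_fun [set: T] (fun x => lebesgue_tuple d [set t | S (tuple_cons (x, t))]).
Proof.
move=> mS.
have mS' : measurable (@tuple_cons R d @^-1` S).
  by rewrite -[X in measurable X]setTI; exact: measurable_tuple_cons.
rewrite (_ : (fun _ => _) =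
  lebesgue_tuple d \o xsection (@tuple_cons R d @^-1` S)); last first.
  apply/funext => x /=; congr (lebesgue_tuple d _).
  by apply/seteqP; split => t /=; rewrite /xsection /= in_setE.
exact: measurable_fun_xsection.
Qed.

Lemma measurable_fun_lebesgue_ysection d (S : set (d.+1.-tuple T)) :
  measurable S ->
  measurable_fun [set: d.-tuple T] (fun t => lam [set x | S (tuple_cons (x, t))]).
Proof.
move=> mS.
have mS' : measurable (@tuple_cons R d @^-1` S).
  by rewrite -[X in measurable X]setTI; exact: measurable_tuple_cons.
rewrite (_ : (fun _ => _) = lam \o ysection (@tuple_cons R d @^-1` S)); last first.
  apply/funext => t /=; congr (lam _).
  by apply/seteqP; split => x /=; rewrite /ysection /= in_setE.
exact: measurable_fun_ysection.
Qed.

Lemma measurable_mxaff_preimage d (A : 'M[R]_d) b (S : set (d.-tuple T)) :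
  measurable S -> measurable (mxaff A b @^-1` S).
Proof.
by move=> mS; rewrite -[X in measurable X]setTI; exact: measurable_mxaff.
Qed.

Lemma ge0_integral_scales_volume d (A : 'M[R]_d) b (f : d.-tuple T -> \bar R) :
  scales_volume A -> measurable_fun [set: _] f -> (forall x, (0 <= f x)%E) ->
  (`|\det A|%:E * \int[lebesgue_tuple d]_t f (mxaff A b t) =
   \int[lebesgue_tuple d]_t f t)%E.
Proof.
move=> hA mf f0.
have ma := measurable_mxaff A b.
pose mu_ : {measure set (d.-tuple T) -> \bar R} :=
  pushforward (lebesgue_tuple d) (mxaff A b).
pose mu := mu_ ma.
rewrite -[X in (_ * X)%E](_ : (\int[mu]_x f x = _)%E); last first.
  by rewrite ge0_integral_pushforward.
rewrite -(ge0_integral_mscale mu measurableT (NngNum (normr_ge0 (\det A))))//.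
by apply: eq_measure_integral => S mS _; exact: hA.
Qed.

(** Tonelli, integrating over the first coordinate last: the section over x of a
    preimage is the preimage of the section over a x + b under an affine map with linear
    part L. *)
Lemma scales_volume_lblock d (a : R) (c : 'cV[R]_d) (L : 'M[R]_d) :
  a != 0 -> scales_volume L ->
  scales_volume (block_mx a%:M 0 c L : 'M[R]_(1 + d)).
Proof.
move=> a0 hL b S mS; rewrite det_lblock det_scalar1 normrM EFinM -muleA.
have mS' := @measurable_mxaff_preimage (1 + d) (block_mx a%:M 0 c L) b S mS.
rewrite [lebesgue_tuple _ S]lebesgue_tuple_xsection.
rewrite [X in (_ * (_ * X))%E]lebesgue_tuple_xsection.
rewrite -[RHS](ge0_integral_affine (b 0 0) a0) => [|//|//]; last first.
  exact: measurable_fun_lebesgue_xsection.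
rewrite -ge0_integralZl//; last first.
  exact: (measurable_fun_lebesgue_xsection mS').
congr (_ * _)%E; apply: eq_integral => x _.
rewrite -[RHS](hL (x *: c + dsubmx b))//; last exact: measurable_tuple_cons_xsection.
by congr (_ * lebesgue_tuple d _)%E; apply/seteqP; split => t /=;
  rewrite mxaff_lblock.
Qed.

(** Tonelli in the other order: here it is the first coordinate whose affine map
    depends on the others. *)
Lemma scales_volume_ublock d (a : R) (c : 'rV[R]_d) (U : 'M[R]_d) :
  a != 0 -> scales_volume U ->
  scales_volume (block_mx a%:M c 0 U : 'M[R]_(1 + d)).
Proof.
move=> a0 hU b S mS; rewrite det_ublock det_scalar1 normrM EFinM.
have mS' := @measurable_mxaff_preimage (1 + d) (block_mx a%:M c 0 U) b S mS.
rewrite [lebesgue_tuple _ S]lebesgue_tuple_ysection//.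
rewrite [X in (_ * X)%E]lebesgue_tuple_ysection; last first.
  exact: measurable_mxaff_preimage.
rewrite -[RHS](ge0_integral_scales_volume (dsubmx b) hU) => [|//|//]; last first.
  exact: measurable_fun_lebesgue_ysection.
rewrite [(`|a|%:E * _)%E]muleC -muleA; congr (_ * _)%E.
rewrite -ge0_integralZl//; last first.
  exact: (measurable_fun_lebesgue_ysection mS').
apply: eq_integral => t _.
rewrite -[RHS](lebesgue_measure_affine ((c *m \col_k tnth t k) 0 0 + b 0 0) a0);
  last first.
  exact: measurable_tuple_cons_ysection.
by congr (_ * lam _)%E; apply/seteqP; split => x /=; rewrite mxaff_ublock.
Qed.

Lemma scales_volume1 d : scales_volume (1%:M : 'M[R]_d).
Proof.
elim: d => [|d IH].
  move=> b S mS; rewrite det1 normr1 mul1e; congr (lebesgue_tuple _ _).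
  by apply/seteqP; split => t /=; rewrite (tuple0 t) (tuple0 (mxaff _ _ _)).
rewrite (_ : 1%:M = block_mx 1%:M 0 0 1%:M :> 'M[R]_(1 + d)); last first.
  exact: scalar_mx_block.
by apply: scales_volume_lblock => //; exact: oner_neq0.
Qed.

(** Elimination on the first column: once the corner entry is invertible the
    matrix is a product of a lower and an upper block-triangular one, to which
    Tonelli applies; a vanishing corner is repaired by adding another row to the
    first one, an operation that is itself block triangular. *)
Lemma unitmx_scales_volume d (A : 'M[R]_d) : A \in unitmx -> scales_volume A.
Proof.
elim: d A => [|d IH] A uA.
  by rewrite (_ : A = 1%:M); [exact: scales_volume1|apply/matrixP => -[]].
have corner (M : 'M[R]_(1 + d)) : M \in unitmx -> M 0 0 != 0 -> scales_volume M.
  move=> uM M0; rewrite -[M]submxK [ulsubmx M]mx11_scalar.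
  set a := ulsubmx M 0 0; set r := ursubmx M.
  set c := dlsubmx M; set N := drsubmx M.
  have a0 : a != 0.
    rewrite (_ : a = M 0 0)// /a !mxE; congr (M _ _); exact/val_inj.
  have E : block_mx a%:M r c N =
      block_mx 1%:M 0 (a^-1 *: c) 1%:M *m block_mx a%:M r 0 (N - a^-1 *: c *m r).
    rewrite mulmx_block !mul1mx !mul0mx !addr0 mul_mx_scalar scalerA mulfV//.
    by rewrite scale1r addrC subrK.
  rewrite E; apply: scales_volumeM.
    by apply: scales_volume_lblock; [exact: oner_neq0|exact: scales_volume1].
  apply: scales_volume_ublock => //; apply: IH.
  move: uM; rewrite -[M]submxK [ulsubmx M]mx11_scalar -/a -/r -/c -/N E.
  rewrite unitmx_mul => /andP[_]; rewrite !unitmxE det_ublock unitrM.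
  by case/andP.
have [A0|] := eqVneq (A 0 0) 0; last exact: corner.
have [i Ai] : exists i, A i 0 != 0.
  apply/existsP; rewrite -negb_forall; apply/negP => /forallP A_0.
  move: uA; rewrite unitmxE (expand_det_col A 0) big1 ?unitr0// => i _.
  by rewrite (eqP (A_0 i)) mul0r.
have [k ik] : exists k, i = lift ord0 k.
  by case: (unliftP ord0 i) Ai => [k ->|->]; [exists k|rewrite A0 eqxx].
(* Left multiplication by E 1 adds row i to row 0. *)
pose E (s : R) : 'M[R]_(1 + d) := block_mx 1%:M (s *: delta_mx 0 k) 0 1%:M.
have EE : E (-1) *m E 1 = 1%:M.
  rewrite /E mulmx_block !mul1mx !mulmx1 !mul0mx !mulmx0 !addr0 !add0r.
  by rewrite -scalerDl subrr scale0r -scalar_mx_block.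
have -> : A = E (-1) *m (E 1 *m A) by rewrite mulmxA EE mul1mx.
apply: scales_volumeM.
  by apply: scales_volume_ublock; [exact: oner_neq0|exact: scales_volume1].
apply: corner.
  by rewrite unitmx_mul uA andbT; have [] := mulmx1_unit EE.
have -> : (E 1 *m A) 0 0 = (E 1 *m A : 'M[R]_(1 + d)) (lshift d 0) (lshift d 0).
  by congr (_ _ _); exact/val_inj.
pose A' : 'M[R]_(1 + d) := A.
rewrite (_ : E 1 *m A = E 1 *m block_mx (ulsubmx A') (ursubmx A')
  (dlsubmx A') (drsubmx A')); last by rewrite submxK.
rewrite mulmx_block block_mxEul mul1mx scale1r -rowE !mxE.
rewrite (_ : A' _ _ = A 0 0); last by congr (A _ _); exact/val_inj.
rewrite A0 add0r (_ : A' _ _ = A i 0)// ik; congr (A _ _); exact/val_inj.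
Qed.

End LinearChangeOfVariables.

(** * Integrable complex functions with a known integral *)

Section HasIntegral.
Context d (X : measurableType d) (R : realType).
Variable mu : {measure set X -> \bar R}.
Implicit Types (f g : X -> R) (F G : X -> R[i]).

(** Integrability and the value of the integral travel together, because linearity and
    Fubini turn such a pair of facts into another and neither half alone suffices. *)
Definition has_rint f (I : R) : Prop :=
  mu.-integrable [set: X] (EFin \o f) /\ (\int[mu]_x (f x)%:E = I%:E)%E.

Definition has_cint F (I : R[i]) : Prop :=
  has_rint (fun x => complex.Re (F x)) (complex.Re I) /\
  has_rint (fun x => complex.Im (F x)) (complex.Im I).

Lemma has_rint_measurable f I : has_rint f I -> measurable_fun [set: X] f.
Proof. by move=> [/integrableP[/measurable_EFinP]]. Qed.

Lemma has_rintD f g I J : has_rint f I -> has_rint g J ->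
  has_rint (fun x => f x + g x) (I + J).
Proof.
move=> [fi fI] [gi gJ]; split.
  have := integrableD measurableT fi gi; apply: eq_integrable => //.
by rewrite -[LHS]/(\int[mu]_x ((EFin \o f) x + (EFin \o g) x))%E integralD//=
   fI gJ.
Qed.

Lemma has_rintZ f I c : has_rint f I -> has_rint (fun x => c * f x) (c * I).
Proof.
move=> [fi fI]; split.
  have := integrableZl measurableT c fi; apply: eq_integrable => //.
rewrite -[LHS]/(\int[mu]_x (c%:E * (EFin \o f) x))%E integralZl//= fI.
by rewrite EFinM.
Qed.

Lemma has_cint_ext F G I : F =1 G -> has_cint F I -> has_cint G I.
Proof. by move=> /funext ->. Qed.

Lemma has_cintD F G I J : has_cint F I -> has_cint G J ->
  has_cint (fun x => F x + G x) (I + J).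
Proof.
move=> [FR FI] [GR GI]; split; under eq_fun do rewrite raddfD /=.
  by rewrite raddfD /=; exact: has_rintD.
by rewrite raddfD /=; exact: has_rintD.
Qed.

Lemma has_cintZ F I c : has_cint F I -> has_cint (fun x => c * F x) (c * I).
Proof.
case: c I => [a b] [I J] [/= FR FI]; split => /=.
  have := has_rintD (has_rintZ a FR) (has_rintZ (- b) FI).
  rewrite mulNr; congr has_rint; apply/funext => x; case: (F x) => u v /=.
  by rewrite mulNr.
have := has_rintD (has_rintZ a FI) (has_rintZ b FR).
by congr has_rint; apply/funext => x; case: (F x) => u v.
Qed.

Lemma has_cint_unique F I J : has_cint F I -> has_cint F J -> I = J.
Proof.
case: I J => [a b] [a' b'] [[_ /= eR] [_ /= eI]] [[_ /=]].
by rewrite eR => -[->] [_ /=]; rewrite eI => -[->].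
Qed.

Lemma has_cint_Rintegral F I : has_cint F I ->
  (\int[mu]_x complex.Re (F x)) +i* (\int[mu]_x complex.Im (F x)) = I.
Proof. by case: I => a b [[_ fa] [_ fb]]; rewrite /Rintegral fa fb. Qed.

End HasIntegral.

Lemma eq_measure_has_rint d (X : measurableType d) (R : realType)
    (mu nu : {measure set X -> \bar R}) (f : X -> R) (I : R) :
  (forall A, measurable A -> mu A = nu A) -> has_rint mu f I -> has_rint nu f I.
Proof.
move=> munu [/integrableP[mf fi] fI]; split.
  apply/integrableP; split => //; move: fi; congr (_ < _)%E.
  by apply: eq_measure_integral => A mA _; rewrite munu.
by rewrite -fI; apply/esym/eq_measure_integral => A mA _; rewrite munu.
Qed.

Section HasIntegralProduct.
Context d1 d2 (X : measurableType d1) (Y : measurableType d2) (R : realType).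
Variables (m1 : {sigma_finite_measure set X -> \bar R}).
Variables (m2 : {sigma_finite_measure set Y -> \bar R}).

Lemma has_rint_prod f g I J : has_rint m1 f I -> has_rint m2 g J ->
  has_rint (m1 \x m2)%E (fun z => f z.1 * g z.2) (I * J).
Proof.
move=> hf hg; have [fi fI] := hf; have [gi gJ] := hg.
have mf := has_rint_measurable hf; have mg := has_rint_measurable hg.
have mfg : measurable_fun [set: X * Y] (fun z => f z.1 * g z.2).
  by apply: measurable_funM; exact: measurableT_comp.
have fgi : (m1 \x m2)%E.-integrable setT (fun z => (f z.1 * g z.2)%:E).
  apply/integrable12ltyP; first exact/measurable_EFinP.
  rewrite (eq_integral (fun x => `|f x|%:E * \int[m2]_y `|g y|%:E)%E); last first.
    move=> x _ /=; rewrite -ge0_integralZl//.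
    - by apply: eq_integral => y _; rewrite normrM EFinM.
    - by apply/measurable_EFinP; exact: measurableT_comp.
  rewrite ge0_integralZr//; last 2 first.
  - by apply/measurable_EFinP; exact: measurableT_comp.
  - by apply: integral_ge0 => y _; rewrite lee_fin.
  apply: lte_mul_pinfty.
  - by apply: integral_ge0 => x _; rewrite lee_fin.
  - move/integrableP : fi => [_ fi]; rewrite ge0_fin_numE//.
    by apply: integral_ge0 => x _; rewrite lee_fin.
  - by move/integrableP : gi => [_ gi].
split => //; rewrite -integral12_prod_meas1//= /fubini_F /=.
rewrite (eq_integral (fun x => ((EFin \o f) x * J%:E)%E)).
  by rewrite integralZr//= fI EFinM.
move=> x _ /=; rewrite -gJ -integralZl//.
Qed.

Lemma has_cint_prod F G I J : has_cint m1 F I -> has_cint m2 G J ->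
  has_cint (m1 \x m2)%E (fun z => F z.1 * G z.2) (I * J).
Proof.
case: I J => [a b] [a' b'] [/= FR FI] [/= GR GI]; split => /=.
  have := has_rintD (has_rint_prod FR GR) (has_rintZ (-1) (has_rint_prod FI GI)).
  rewrite mulN1r; congr has_rint; apply/funext => z.
  by case: (F z.1) (G z.2) => u v [u' v'] /=; rewrite mulN1r.
have := has_rintD (has_rint_prod FR GI) (has_rint_prod FI GR).
congr has_rint; apply/funext => z.
by case: (F z.1) (G z.2) => u v [u' v'] /=.
Qed.

End HasIntegralProduct.

Section LebesgueTupleIntegral.
Context {R : realType}.
Local Notation T := (measurableTypeR R).
Local Notation lam := (@lebesgue_measure R).

Lemma has_rint_unitmx d (A : 'M[R]_d) (f : d.-tuple T -> R) I :
  A \in unitmx ->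
  has_rint (lebesgue_tuple d) (fun t => f (mxaff A 0 t)) I ->
  has_rint (lebesgue_tuple d) f (`|\det A| * I).
Proof.
move=> uA hf; have [fi fI] := hf; have hA := unitmx_scales_volume uA.
have mf : measurable_fun [set: d.-tuple T] f.
  rewrite (_ : f = (fun t => f (mxaff A 0 t)) \o mxaff (invmx A) 0).
    apply: measurableT_comp; first exact: has_rint_measurable hf.
    exact: measurable_mxaff.
  by apply/funext => t /=; rewrite mxaff_comp mulmxV// mulmx0 add0r mxaff1.
split.
  apply/integrableP; split; first exact/measurable_EFinP.
  rewrite -(ge0_integral_scales_volume 0 hA)//; last first.
    by apply/measurable_EFinP; exact: measurableT_comp.
  apply: lte_mul_pinfty => //.
  by move/integrableP : fi => [].
have mEf : measurable_fun [set: d.-tuple T] (EFin \o f) by exact/measurable_EFinP.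
rewrite integralE -(ge0_integral_scales_volume 0 hA)//; last first.
  exact: measurable_funepos.
rewrite -(ge0_integral_scales_volume 0 hA (measurable_funeneg mEf))//.
move: fI; rewrite integralE; have := integrable_pos_fin_num measurableT fi.
have := integrable_neg_fin_num measurableT fi.
rewrite (_ : (\int[_]_x _^\- x)%E =
  (\int[lebesgue_tuple d]_t (EFin \o f)^\- (mxaff A 0 t))%E); last first.
  by apply: eq_integral => t _; rewrite !funenegE.
rewrite (_ : (\int[_]_x (_ \o _)^\+ x)%E =
  (\int[lebesgue_tuple d]_t (EFin \o f)^\+ (mxaff A 0 t))%E); last first.
  by apply: eq_integral => t _; rewrite !funeposE.
move=> /fineK <- /fineK <-.
by rewrite -!EFinM -!EFinB => -[<-]; rewrite mulrBr.
Qed.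

Lemma has_cint_unitmx d (A : 'M[R]_d) (F : d.-tuple T -> R[i]) I :
  A \in unitmx ->
  has_cint (lebesgue_tuple d) (fun t => F (mxaff A 0 t)) I ->
  has_cint (lebesgue_tuple d) F (`|\det A|%:C * I).
Proof.
move=> uA [FR FI]; split.
  have := has_rint_unitmx (f := fun t => complex.Re (F t)) uA FR.
  by congr has_rint; case: I {FR FI} => a b /=; rewrite mul0r subr0.
have := has_rint_unitmx (f := fun t => complex.Im (F t)) uA FI.
by congr has_rint; case: I {FR FI} => a b /=; rewrite mul0r addr0.
Qed.

(** A name of its own for the product measure lets it carry the sigma-finiteness
    that a further product with Lebesgue measure on the other coordinates needs. *)
Definition plane : set (T * T)%type -> \bar R := product_measure1 lam lam.

HB.instance Definition _ := Measure.copy plane (product_measure1 lam lam).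

Let plane_sigma_finite : sigma_finite [set: (T * T)%type] plane.
Proof.
have /sigma_finiteP[F [TF ndF Foo]] := sigma_finiteT lam.
exists (fun n => F n `*` F n).
  rewrite -setXTT TF predeqE => -[x y]; split.
    move=> [/= [n _ Fnx] [k _ Fky]]; exists (maxn n k) => //; split.
    - by move: x Fnx; exact/subsetPset/ndF/leq_maxl.
    - by move: y Fky; exact/subsetPset/ndF/leq_maxr.
  by move=> [n _ []/= ? ?]; split; exists n.
move=> k; have [? ?] := Foo k; split; first exact: measurableX.
by rewrite /plane product_measure1E// lte_mul_pinfty// ge0_fin_numE.
Qed.

HB.instance Definition _ := Measure_isSigmaFinite.Build _ _ _ plane
  plane_sigma_finite.

Definition tuple_cons2 d (p : (T * T) * d.-tuple T) : d.+2.-tuple T :=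
  tuple_cons (p.1.1, tuple_cons (p.1.2, p.2)).

Lemma measurable_tuple_cons2 d : measurable_fun [set: _] (@tuple_cons2 d).
Proof.
apply: measurable_cons => /=.
  exact: (measurableT_comp measurable_fst measurable_fst).
apply: measurable_cons => /=; last exact: measurable_snd.
exact: (measurableT_comp measurable_snd measurable_fst).
Qed.

Lemma lebesgue_tuple_cons2 d (S : set (d.+2.-tuple T)) : measurable S ->
  lebesgue_tuple d.+2 S =
  (plane \x lebesgue_tuple d)%E (@tuple_cons2 d @^-1` S).
Proof.
move=> mS; have mS' : measurable (@tuple_cons2 d @^-1` S).
  by rewrite -[X in measurable X]setTI; exact: measurable_tuple_cons2.
pose phi (p : T * T) := lebesgue_tuple d (xsection (@tuple_cons2 d @^-1` S) p).
have mphi : measurable_fun [set: T * T] phi by exact: measurable_fun_xsection.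
have phi0 p : (0 <= phi p)%E by exact: measure_ge0.
rewrite -[RHS]/(\int[plane]_p phi p)%E.
rewrite (fubini_tonelli1 phi mphi phi0) /fubini_F lebesgue_tuple_xsection.
apply: eq_integral => x _; rewrite lebesgue_tuple_xsection.
apply: eq_integral => y _; rewrite /phi; congr (lebesgue_tuple d _).
by apply/seteqP; split => t /=; rewrite /xsection /= in_setE.
Qed.

Lemma has_rint_tuple_cons2 d (f : d.+2.-tuple T -> R) I :
  measurable_fun [set: _] f ->
  has_rint (plane \x lebesgue_tuple d)%E (fun p => f (tuple_cons2 p)) I ->
  has_rint (lebesgue_tuple d.+2) f I.
Proof.
move=> mf [fi fI]; have mc := @measurable_tuple_cons2 d.
pose nu_ : {measure set (d.+2.-tuple T) -> \bar R} :=
  pushforward (plane \x lebesgue_tuple d)%E (@tuple_cons2 d).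
pose nu := nu_ mc.
apply: (@eq_measure_has_rint _ _ _ nu).
  by move=> S mS; exact: esym (lebesgue_tuple_cons2 mS).
split.
  by apply: integrable_pushforward => //; exact/measurable_EFinP.
by rewrite integral_pushforward//; exact/measurable_EFinP.
Qed.

Lemma has_cint_tuple_cons2 d (H : T * T -> R[i]) (G : d.-tuple T -> R[i]) I J :
  has_cint plane H I -> has_cint (lebesgue_tuple d) G J ->
  has_cint (lebesgue_tuple d.+2)
    (fun t => H (thead t, thead [tuple of behead t]) *
              G [tuple of behead [tuple of behead t]]) (I * J).
Proof.
move=> hH hG; have [pR pI] := has_cint_prod hH hG.
have E (p : (T * T) * d.-tuple T) :
    (thead (tuple_cons2 p), thead [tuple of behead (tuple_cons2 p)]) = p.1 /\
    [tuple of behead [tuple of behead (tuple_cons2 p)]] = p.2.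
  by case: p => [[x y] t]; split; [congr (_, _)|exact/val_inj].
have mg : measurable_fun [set: d.+2.-tuple T] (fun t : d.+2.-tuple T =>
   ((thead t, thead [tuple of behead t]),
    [tuple of behead [tuple of behead t]]) : (T * T) * d.-tuple T).
  have mb : measurable_fun [set: d.+2.-tuple T]
     (fun t => [tuple of behead t] : d.+1.-tuple T) by exact: measurable_behead.
  apply/measurable_fun_pairP; split => /=.
    apply/measurable_fun_pairP; split => /=; first exact: measurable_tnth.
    by apply: (measurableT_comp (measurable_tnth _) mb).
  apply: (measurableT_comp (f := fun t : d.+1.-tuple T => [tuple of behead t])) => //.
  exact: measurable_behead.
split.
  apply: has_rint_tuple_cons2.
    apply: (measurableT_comp (f := fun p => complex.Re (H p.1 * G p.2)) _ mg).
    exact: has_rint_measurable pR.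
  by move: pR; congr has_rint; apply/funext => p; have [-> ->] := E p.
apply: has_rint_tuple_cons2.
  apply: (measurableT_comp (f := fun p => complex.Im (H p.1 * G p.2)) _ mg).
  exact: has_rint_measurable pI.
by move: pI; congr has_rint; apply/funext => p; have [-> ->] := E p.
Qed.

Lemma has_cint_lebesgue_tuple0 (F : 0.-tuple T -> R[i]) :
  has_cint (lebesgue_tuple 0) F (F [tuple]).
Proof.
have h (f : 0.-tuple T -> R) : has_rint (lebesgue_tuple 0) f (f [tuple]).
  have mf : measurable_fun [set: 0.-tuple T] f.
    rewrite (_ : f = cst (f [tuple])); first exact: measurable_cst.
    by apply/funext => t; rewrite (tuple0 t).
  split; last first.
    by rewrite /= integral_dirac//= ?diracT ?mul1e//; exact/measurable_EFinP.
  apply/integrableP; split; first exact/measurable_EFinP.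
  rewrite /= integral_dirac//= ?diracT ?mul1e ?ltry//.
  by do 2 apply: measurableT_comp => //.
by split; exact: h.
Qed.

(** Fubini, two coordinates at a time, along the recursive definition of the
    measure. *)
Lemma has_cint_prod_pairs n (H : 'I_n -> T * T -> R[i]) (I : 'I_n -> R[i]) :
  (forall j, has_cint plane (H j) (I j)) ->
  has_cint (lebesgue_tuple n.*2)
    (fun t => \prod_j H j (tnth t (fst_idx j), tnth t (snd_idx j)))
    (\prod_j I j).
Proof.
elim: n H I => [|n IH] H I h.
  have := has_cint_lebesgue_tuple0 (fun=> 1).
  by rewrite big_ord0; apply: has_cint_ext => t; rewrite big_ord0.
have := has_cint_tuple_cons2 (h ord0) (IH _ _ (fun j => h (lift ord0 j))).
rewrite big_ord_recl; apply: has_cint_ext => t.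
rewrite big_ord_recl; case/tupleP : t => x t; case/tupleP : t => y t.
congr (H _ (_, _) * _); rewrite ?(tnth_nth 0) ?theadE//.
apply: eq_bigr => j _; by congr (H _ (_, _)); rewrite !(tnth_nth 0).
Qed.

End LebesgueTupleIntegral.

(** * Integration by parts against a complex Gaussian *)

Section ComplexCalculus.
Context {R : realType}.
Implicit Types (f g : R -> R[i]) (l z w : R[i]).
Local Notation Re := (@complex.Re R).
Local Notation Im := (@complex.Im R).

Definition is_cderive f (x : R) l :=
  is_derive x 1 (fun t => Re (f t)) (Re l) /\
  is_derive x 1 (fun t => Im (f t)) (Im l).

Lemma is_cderive_cst w x : is_cderive (fun=> w) x 0.
Proof. by split; exact: is_derive_cst. Qed.

Lemma is_cderive_ext f g x l : f =1 g -> is_cderive f x l -> is_cderive g x l.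
Proof. by move=> /funext ->. Qed.

Lemma is_cderiveD f g x a b : is_cderive f x a -> is_cderive g x b ->
  is_cderive (fun t => f t + g t) x (a + b).
Proof.
move=> [fR fI] [gR gI]; split; rewrite raddfD; under eq_fun do rewrite raddfD;
  exact: is_deriveD.
Qed.

Lemma is_cderiveM f g x a b : is_cderive f x a -> is_cderive g x b ->
  is_cderive (fun t => f t * g t) x (a * g x + f x * b).
Proof.
move=> [fR fI] [gR gI]; split.
  have := is_deriveB (is_deriveM fR gR) (is_deriveM fI gI).
  rewrite (_ : _ - _ = fun t => Re (f t * g t)); last first.
    by apply/funext => t /=; rewrite !fctE; case: (f t) (g t) => u v [u' v'].
  move=> h; apply: (is_derive_eq h) => /=; rewrite /GRing.scale /=.
  by case: a b (f x) (g x) {fR fI gR gI h} => [? ?] [? ?] [? ?] [? ?] /=; ring.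
have := is_deriveD (is_deriveM fR gI) (is_deriveM fI gR).
rewrite (_ : _ + _ = fun t => Im (f t * g t)); last first.
  by apply/funext => t /=; rewrite !fctE; case: (f t) (g t) => u v [u' v'].
move=> h; apply: (is_derive_eq h) => /=; rewrite /GRing.scale /=.
by case: a b (f x) (g x) {fR fI gR gI h} => [? ?] [? ?] [? ?] [? ?] /=; ring.
Qed.

Definition cexp z : R[i] := (expR (Re z))%:C * expi (Im z).

Lemma cexpE z :
  cexp z = (expR (Re z) * cos (Im z)) +i* (expR (Re z) * sin (Im z)).
Proof. by rewrite /cexp /expi /=; simpc. Qed.

Lemma expiD (s t : R) : expi (s + t) = expi s * expi t.
Proof. by rewrite /expi; simpc; rewrite cosD sinD [sin s * _ + _]addrC. Qed.

Lemma cexpD z w : cexp (z + w) = cexp z * cexp w.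
Proof.
rewrite /cexp !raddfD /= expRD expiD rmorphM /=; ring.
Qed.

Lemma is_cderive_cexp f x l : is_cderive f x l ->
  is_cderive (fun t => cexp (f t)) x (l * cexp (f x)).
Proof.
move=> [fR fI].
have eR := is_derive1_comp (is_derive_expR (Re (f x))) fR.
have cI := is_derive1_comp (is_derive_cos (Im (f x))) fI.
have sI := is_derive1_comp (is_derive_sin (Im (f x))) fI.
split.
  under eq_fun do rewrite cexpE.
  have := is_deriveM eR cI; move=> h; apply: (is_derive_eq h).
  by rewrite cexpE /GRing.scale /=; case: l {fR fI eR cI sI h} => a b /=; ring.
under eq_fun do rewrite cexpE.
have := is_deriveM eR sI; move=> h; apply: (is_derive_eq h).
by rewrite cexpE /GRing.scale /=; case: l {fR fI eR cI sI h} => a b /=; ring.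
Qed.

Local Notation normc := (@ComplexField.Normc.normc R).

Lemma normc_ge0 z : 0 <= normc z.
Proof. by case: z => a b; exact: sqrtr_ge0. Qed.

Lemma Re_le_normc z : `|Re z| <= normc z.
Proof.
case: z => a b /=; rewrite -sqrtr_sqr ler_sqrt ?addr_ge0 ?sqr_ge0//.
by rewrite lerDl sqr_ge0.
Qed.

Lemma Im_le_normc z : `|Im z| <= normc z.
Proof.
case: z => a b /=; rewrite -sqrtr_sqr ler_sqrt ?addr_ge0 ?sqr_ge0//.
by rewrite lerDr sqr_ge0.
Qed.

Lemma normcM z w : normc (z * w) = normc z * normc w.
Proof. exact: ComplexField.Normc.normcM. Qed.

Lemma normc_cexp z : normc (cexp z) = expR (Re z).
Proof.
by rewrite cexpE /= !exprMn -mulrDr cos2Dsin2 mulr1 sqrtr_sqr ger0_norm//.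
Qed.

Lemma normc_conj z : normc z^* = normc z.
Proof. by case: z => a b /=; rewrite sqrrN. Qed.

Lemma sqr_normcE z : normc z ^+ 2 = Re z ^+ 2 + Im z ^+ 2.
Proof. by case: z => a b /=; rewrite sqr_sqrtr// addr_ge0 ?sqr_ge0. Qed.

Definition ccontinuous f :=
  continuous (fun t => Re (f t) : R^o) /\ continuous (fun t => Im (f t) : R^o).

Lemma ccontinuousD f g : ccontinuous f -> ccontinuous g ->
  ccontinuous (fun t => f t + g t).
Proof.
move=> [fR fI] [gR gI]; split; under eq_fun do rewrite raddfD.
  by move=> x; apply: cvgD; [exact: fR|exact: gR].
by move=> x; apply: cvgD; [exact: fI|exact: gI].
Qed.

Lemma ccontinuousM f g : ccontinuous f -> ccontinuous g ->
  ccontinuous (fun t => f t * g t).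
Proof.
move=> [fR fI] [gR gI]; split.
  rewrite (_ : (fun _ => _) = fun t => Re (f t) * Re (g t) - Im (f t) * Im (g t)).
    move=> x; apply: cvgB; apply: cvgM;
      [exact: fR|exact: gR|exact: fI|exact: gI].
  by apply/funext => t; case: (f t) (g t) => u v [u' v'].
rewrite (_ : (fun _ => _) = fun t => Re (f t) * Im (g t) + Im (f t) * Re (g t)).
  move=> x; apply: cvgD; apply: cvgM;
    [exact: fR|exact: gI|exact: fI|exact: gR].
by apply/funext => t; case: (f t) (g t) => u v [u' v'].
Qed.

Lemma is_cderive_ccontinuous f (df : R -> R[i]) :
  (forall x, is_cderive f x (df x)) -> ccontinuous f.
Proof.
move=> h; split => x; have [[fR _] [fI _]] := h x.
  exact/differentiable_continuous/derivable1_diffP.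
exact/differentiable_continuous/derivable1_diffP.
Qed.

End ComplexCalculus.

Section GaussianDecay.
Context {R : realType}.
Local Notation T := (measurableTypeR R).
Local Notation lam := (@lebesgue_measure R).

(** The integral over the interval from -n to n is F n - F (-n); dominated convergence
    lets n tend to infinity. *)
Lemma has_rint_derive (F f : R -> R) :
  (forall x : R, is_derive x 1 F (f x)) -> continuous (f : R -> R^o) ->
  lam.-integrable [set: T] (EFin \o f) ->
  F n%:R @[n --> \oo] --> 0 -> F (- n%:R) @[n --> \oo] --> 0 ->
  has_rint lam (f : T -> R) 0.
Proof.
move=> dF cf fi F1 F2; split => //.
pose I (n : nat) : set T := `[- n%:R, n%:R]%classic.
have mf : measurable_fun [set: T] (EFin \o f) by case/integrableP : fi.
have mfI n : measurable_fun [set: T] ((EFin \o f) \_ (I n)).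
  apply/(measurable_restrictT _ _).1; last exact: measurable_funTS.
  exact: measurable_itv.
have [] := @dominated_convergence _ T R lam setT measurableT
  (fun n => (EFin \o f) \_ (I n)) (EFin \o f) (abse \o (EFin \o f)) mfI mf.
- apply: aeW => x _; apply: cvg_near_cst; near=> n.
  rewrite patchE ifT// inE /I /= in_itv /= -ler_norml.
  near: n; exact: nbhs_infty_ger.
- exact: integrable_abse.
- apply: aeW => x n _; rewrite patchE; case: ifP => // _.
  by rewrite abse0 abse_ge0.
move=> _ _ /= /cvg_lim <- //; apply/cvg_lim => //.
have E n : ((\int[lam]_x ((EFin \o f) \_ (I n.+1)) x) =
    (F n.+1%:R - F (- n.+1%:R))%:E)%E.
  rewrite -integral_mkcond /I (continuous_FTC2 (F := F))//.
  - by rewrite -subr_gt0 opprK addr_gt0.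
  - by apply: continuous_subspaceT.
  - have cF x : {for x, continuous F}.
      by apply/differentiable_continuous/derivable1_diffP; have [] := dF x.
    split; first by move=> x _; have [] := dF x.
      exact/cvg_at_right_filter/cF.
    exact/cvg_at_left_filter/cF.
  - by move=> x _; rewrite derive1E; have [_ ->] := dF x.
rewrite -(cvg_shiftS _) /=; under eq_fun do rewrite E.
apply: cvg_EFin; first exact: nearW.
rewrite /comp /= -[0]subr0; apply: cvgB.
  by move: F1; rewrite -(cvg_shiftS _).
by move: F2; rewrite -(cvg_shiftS _).
Unshelve. all: by end_near. Qed.

Definition gauss2 (x y : R) : R := expR (- (x ^+ 2 + y ^+ 2) / 2).

Lemma has_rint_half_gauss : exists I : R,
  has_rint lam (fun x : T => expR (- (x ^+ 2) / 2)) I.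
Proof.
pose s : R := (Num.sqrt 2)^-1.
have s0 : s != 0 by rewrite invr_eq0 sqrtr_eq0 -ltNge.
have E (x : T) : expR (- (x ^+ 2) / 2) = gauss_fun (s * x + 0).
  by rewrite /gauss_fun addr0 exprMn exprVn sqr_sqrtr// mulrC mulrN.
have mE : measurable_fun [set: T] (EFin \o (fun x : T => expR (- (x ^+ 2) / 2))).
  apply/measurable_EFinP/measurableT_comp => //.
  apply: measurable_funM => //; apply: measurableT_comp => //.
have := @ge0_integral_affine R s 0 (EFin \o gauss_fun) s0.
rewrite integralT_gauss /= => H.
have {}H := H ((measurable_EFinP _ _).2 measurable_gauss_fun)
  (fun x => gauss_fun_ge0 x).
exists (`|s|^-1 * Num.sqrt pi).
have I : (\int[lam]_x (expR (- (x ^+ 2) / 2))%:E = (`|s|^-1 * Num.sqrt pi)%:E)%E.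
  rewrite EFinM -H muleA -EFinM mulVf ?normr_eq0// mul1e.
  by apply: eq_integral => x _; rewrite E.
split => //; apply/integrableP; split => //.
under eq_integral do rewrite /= ger0_norm ?expR_ge0//.
by rewrite I ltry.
Qed.

Lemma integrable_gauss2 :
  (@plane R).-integrable setT (fun z => (gauss2 z.1 z.2)%:E).
Proof.
have [I hI] := has_rint_half_gauss.
have [gi _] := has_rint_prod hI hI.
apply: eq_integrable gi => // z _ /=.
by rewrite -expRD /gauss2 -mulrDl -opprD.
Qed.

Lemma cvg_half_gauss_nat : expR (- (n%:R ^+ 2) / 2 : R) @[n --> \oo] --> 0.
Proof.
apply: (@squeeze_cvgr _ _ _ _ (cst 0) (fun n => 2 * @harmonic R n)).
- near=> n; rewrite expR_ge0 /= mulNr expRN /harmonic /=.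
  rewrite -[X in _ <= X * _](invrK 2) -invfM lef_pV2 ?posrE ?mulr_gt0 ?expR_gt0//.
  apply: le_trans (expR_ge1Dx _).
  have := ler0n R n; have := sqr_ge0 (n%:R - 1 : R); rewrite -[n.+1%:R]natr1; lra.
- exact: cvg_cst.
- by rewrite -(mulr0 2); apply: cvgMr; exact: cvg_harmonic.
Unshelve. all: by end_near. Qed.

End GaussianDecay.

Section WirtingerCalculus.
Context {R : realType}.
Local Notation T := (measurableTypeR R).
Local Notation lam := (@lebesgue_measure R).
Local Notation C := R[i].
Local Notation Re := (@complex.Re R).
Local Notation Im := (@complex.Im R).
Local Notation normc := (@ComplexField.Normc.normc R).
Implicit Types (f g : C -> C) (alpha : C).

Definition plane_point (z : T * T) : C := z.1 +i* z.2.

Definition cmeasurable (F : T * T -> C) :=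
  measurable_fun [set: T * T] (fun z => Re (F z)) /\
  measurable_fun [set: T * T] (fun z => Im (F z)).

Lemma cmeasurableD F G : cmeasurable F -> cmeasurable G ->
  cmeasurable (fun z => F z + G z).
Proof.
move=> [FR FI] [GR GI]; split; under eq_fun do rewrite raddfD;
  exact: measurable_funD.
Qed.

Lemma cmeasurableM F G : cmeasurable F -> cmeasurable G ->
  cmeasurable (fun z => F z * G z).
Proof.
move=> [FR FI] [GR GI]; split.
  rewrite (_ : (fun _ => _) = fun z => Re (F z) * Re (G z) - Im (F z) * Im (G z)).
    by apply: measurable_funB; exact: measurable_funM.
  by apply/funext => z; case: (F z) (G z) => u v [u' v'].
rewrite (_ : (fun _ => _) = fun z => Re (F z) * Im (G z) + Im (F z) * Re (G z)).
  by apply: measurable_funD; exact: measurable_funM.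
by apply/funext => z; case: (F z) (G z) => u v [u' v'].
Qed.

Lemma cmeasurable_cexp F : cmeasurable F -> cmeasurable (fun z => cexp (F z)).
Proof.
move=> [FR FI]; split; under eq_fun do rewrite cexpE /=.
  apply: measurable_funM; first exact: (measurableT_comp (@measurable_expR R) FR).
  apply: (measurableT_comp (f := @cos R) _ FI).
  by apply: continuous_measurable_fun => x; exact: continuous_cos.
apply: measurable_funM; first exact: (measurableT_comp (@measurable_expR R) FR).
apply: (measurableT_comp (f := @sin R) _ FI).
by apply: continuous_measurable_fun => x; exact: continuous_sin.
Qed.

(** The class in which all integrands live: growth at most exponential makes them
    integrable against a Gaussian, and continuity along the two axes is what the
    fundamental theorem of calculus asks of a derivative. *)
Record tame f : Prop := {
  tame_measurable : cmeasurable (fun z => f (plane_point z)) ;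
  tame_growth : exists c a : R, [/\ 0 <= c, 0 <= a &
    forall w, normc (f w) <= c * expR (a * normc w)] ;
  tame_continuous_x : forall y, ccontinuous (fun x => f (x +i* y)) ;
  tame_continuous_y : forall x, ccontinuous (fun y => f (x +i* y)) }.

Lemma ccontinuous_cst w : ccontinuous (fun _ : R => w).
Proof. by split => x; exact: cst_continuous. Qed.

Lemma tame_cst w : tame (fun=> w).
Proof.
split; [by split; exact: measurable_cst| |by move=> y; exact: ccontinuous_cst..].
exists (normc w), 0; split; [exact: normc_ge0|by []|].
by move=> z; rewrite mul0r expR0 mulr1.
Qed.

Lemma tame_id : tame id.
Proof.
split.
- by split => /=; [exact: measurable_fst|exact: measurable_snd].
- exists 1, 1; split => // w; rewrite !mul1r.
  by apply: le_trans (expR_ge1Dx _); rewrite lerDr.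
- by move=> y; split => x /=; [exact: cvg_id|exact: cst_continuous].
- by move=> y; split => x /=; [exact: cst_continuous|exact: cvg_id].
Qed.

Lemma tame_conj : tame (@conjc R).
Proof.
split.
- split => /=; first exact: measurable_fst.
  by apply: measurableT_comp => //; exact: measurable_snd.
- exists 1, 1; split => // w; rewrite !mul1r normc_conj.
  by apply: le_trans (expR_ge1Dx _); rewrite lerDr.
- by move=> y; split => x /=; [exact: cvg_id|exact: cst_continuous].
- by move=> y; split => x /=; [exact: cst_continuous|apply: cvgN; exact: cvg_id].
Qed.

Lemma tameD f g : tame f -> tame g -> tame (fun w => f w + g w).
Proof.
move=> [mf [c [a [c0 a0 hf]]] fx fy] [mg [c' [a' [c'0 a'0 hg]]] gx gy]; split.
- exact: cmeasurableD.
- exists (c + c'), (a + a'); split; [exact: addr_ge0..|move=> w].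
  apply: le_trans (le_normcD _ _) _.
  rewrite mulrDl; apply: lerD.
    apply: le_trans (hf w) _; apply: ler_wpM2l => //.
    by rewrite ler_expR ler_wpM2r ?normc_ge0// lerDl.
  apply: le_trans (hg w) _; apply: ler_wpM2l => //.
  by rewrite ler_expR ler_wpM2r ?normc_ge0// lerDr.
- by move=> y; exact: ccontinuousD.
- by move=> y; exact: ccontinuousD.
Qed.

Lemma tameM f g : tame f -> tame g -> tame (fun w => f w * g w).
Proof.
move=> [mf [c [a [c0 a0 hf]]] fx fy] [mg [c' [a' [c'0 a'0 hg]]] gx gy]; split.
- exact: cmeasurableM.
- exists (c * c'), (a + a'); split; [exact: mulr_ge0|exact: addr_ge0|move=> w].
  rewrite normcM mulrDl expRD mulrACA; apply: ler_pM => //; exact: normc_ge0.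
- by move=> y; exact: ccontinuousM.
- by move=> y; exact: ccontinuousM.
Qed.

(** The Wirtinger derivatives fz, in w, and fzb, in conj w, are encoded by what they
    make of the derivatives along the two axes. Tameness is part of the record so that
    integration by parts can be applied to any instance of it. *)
Record wirtinger f fz fzb : Prop := {
  wirtinger_tame : tame f ;
  wirtinger_tame_z : tame fz ;
  wirtinger_tame_zb : tame fzb ;
  wirtinger_dx : forall x y,
    is_cderive (fun t => f (t +i* y)) x (fz (x +i* y) + fzb (x +i* y)) ;
  wirtinger_dy : forall x y,
    is_cderive (fun t => f (x +i* t)) y ('i * (fz (x +i* y) - fzb (x +i* y))) }.

Lemma wirtinger_cst w : wirtinger (fun=> w) (fun=> 0) (fun=> 0).
Proof.
split; [exact: tame_cst..| |] => x y; rewrite ?addr0 ?subr0 ?mulr0;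
  exact: is_cderive_cst.
Qed.

Lemma wirtinger_id : wirtinger id (fun=> 1) (fun=> 0).
Proof.
split; [exact: tame_id|exact: tame_cst|exact: tame_cst| |] => x y.
  by rewrite addr0; split => /=; [exact: is_derive_id|exact: is_derive_cst].
rewrite subr0 mulr1; split => /=; first exact: is_derive_cst.
exact: is_derive_id.
Qed.

Lemma wirtinger_conj : wirtinger (@conjc R) (fun=> 0) (fun=> 1).
Proof.
split; [exact: tame_conj|exact: tame_cst|exact: tame_cst| |] => x y.
  rewrite add0r; split => /=; first exact: is_derive_id.
  exact: is_derive_cst.
rewrite sub0r mulrN1; split => /=; last exact: is_deriveNid.
by rewrite oppr0; exact: is_derive_cst.
Qed.

Lemma wirtingerD f fz fzb g gz gzb :
  wirtinger f fz fzb -> wirtinger g gz gzb ->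
  wirtinger (fun w => f w + g w) (fun w => fz w + gz w) (fun w => fzb w + gzb w).
Proof.
move=> [f1 f2 f3 fx fy] [g1 g2 g3 gx gy]; split; [exact: tameD..| |] => x y.
  by rewrite addrACA; exact: is_cderiveD.
by rewrite opprD addrACA mulrDr; exact: is_cderiveD.
Qed.

Lemma wirtingerM f fz fzb g gz gzb :
  wirtinger f fz fzb -> wirtinger g gz gzb ->
  wirtinger (fun w => f w * g w) (fun w => fz w * g w + f w * gz w)
    (fun w => fzb w * g w + f w * gzb w).
Proof.
move=> [f1 f2 f3 fx fy] [g1 g2 g3 gx gy].
split; [exact: tameM|by apply: tameD; exact: tameM..| |] => x y.
  rewrite [X in is_cderive _ _ X](_ : _ =
    (fz (x +i* y) + fzb (x +i* y)) * g (x +i* y) +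
    f (x +i* y) * (gz (x +i* y) + gzb (x +i* y))); last by ring.
  exact: (is_cderiveM (fx x y) (gx x y)).
rewrite [X in is_cderive _ _ X](_ : _ =
  ('i * (fz (x +i* y) - fzb (x +i* y))) * g (x +i* y) +
  f (x +i* y) * ('i * (gz (x +i* y) - gzb (x +i* y)))); last by ring.
exact: (is_cderiveM (fy x y) (gy x y)).
Qed.

Lemma wirtinger_ext f fz fzb g gz gzb :
  f =1 g -> fz =1 gz -> fzb =1 gzb -> wirtinger f fz fzb -> wirtinger g gz gzb.
Proof. by move=> /funext -> /funext -> /funext ->. Qed.

End WirtingerCalculus.

Lemma integrable_has_rint d (X : measurableType d) (R : realType)
    (mu : {measure set X -> \bar R}) (f : X -> R) :
  mu.-integrable setT (EFin \o f) -> has_rint mu f (\int[mu]_x f x).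
Proof.
by move=> fi; split => //; rewrite /Rintegral fineK//; exact: integrable_fin_num.
Qed.

Section GaussianIntegral.
Context {R : realType}.
Local Notation T := (measurableTypeR R).
Local Notation lam := (@lebesgue_measure R).
Local Notation plane := (@plane R).
Local Notation C := R[i].
Local Notation Re := (@complex.Re R).
Local Notation Im := (@complex.Im R).
Local Notation normc := (@ComplexField.Normc.normc R).
Implicit Types (f g : C -> C) (alpha : C).

Lemma gauss2_integrable_dominated (h : T * T -> R) (c : R) :
  measurable_fun [set: T * T] h ->
  (forall z, `|h z| <= c * gauss2 z.1 z.2) ->
  plane.-integrable setT (EFin \o h).
Proof.
move=> mh hc.
have := integrableZl measurableT c (@integrable_gauss2 R).
apply: le_integrable => //; first exact/measurable_EFinP.
move=> z _ /=; rewrite lee_fin; apply: le_trans (hc z) _.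
exact: ler_norm.
Qed.

Lemma gauss2_split (x y : R) :
  gauss2 x y = expR (- (x ^+ 2) / 2) * expR (- (y ^+ 2) / 2).
Proof. by rewrite /gauss2 -expRD -mulrDl -opprD. Qed.

Lemma integrable_half_gauss_dominated (h : T -> R) (c : R) :
  measurable_fun [set: T] h ->
  (forall x, `|h x| <= c * expR (- (x ^+ 2) / 2)) ->
  lam.-integrable setT (EFin \o h).
Proof.
move=> mh hc; have [I [gi _]] := @has_rint_half_gauss R.
have := integrableZl measurableT c gi.
apply: le_integrable => //; first exact/measurable_EFinP.
move=> z _ /=; rewrite lee_fin; apply: le_trans (hc z) _.
exact: ler_norm.
Qed.

Lemma cvg0_half_gauss_dominated (F : R -> R) (c : R) :
  (forall x, `|F x| <= c * expR (- (x ^+ 2) / 2)) ->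
  F n%:R @[n --> \oo] --> 0 /\ F (- n%:R) @[n --> \oo] --> 0.
Proof.
move=> hF.
have h0 : c * expR (- (n%:R ^+ 2) / 2) @[n --> \oo] --> 0.
  by rewrite -(mulr0 c); apply: cvgMr; exact: cvg_half_gauss_nat.
split; apply: norm_cvg0; apply: (@squeeze_cvgr _ _ _ _ (cst 0) _ _ _ _ _ h0);
  try exact: cvg_cst; apply: nearW => n; rewrite normr_ge0 /=.
  exact: hF.
by apply: le_trans (hF _) _; rewrite sqrrN.
Qed.

Lemma has_rint_half_gauss_derive (F f : R -> R) (c c' : R) :
  (forall x : R, is_derive x 1 F (f x)) -> continuous (f : R -> R^o) ->
  (forall x, `|F x| <= c * expR (- (x ^+ 2) / 2)) ->
  (forall x, `|f x| <= c' * expR (- (x ^+ 2) / 2)) ->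
  has_rint lam (f : T -> R) 0.
Proof.
move=> dF cf Fc fc; have [F1 F2] := cvg0_half_gauss_dominated Fc.
apply: (has_rint_derive dF cf) => //.
by apply: integrable_half_gauss_dominated fc; exact: continuous_measurable_fun.
Qed.

Lemma has_rint_plane_dx (F f : T * T -> R) (c c' : R) :
  measurable_fun [set: T * T] f ->
  (forall x y : R, is_derive x 1 (fun t => F (t, y)) (f (x, y))) ->
  (forall y, continuous (fun x : R => f (x, y) : R^o)) ->
  (forall z, `|F z| <= c * gauss2 z.1 z.2) ->
  (forall z, `|f z| <= c' * gauss2 z.1 z.2) ->
  has_rint plane f 0.
Proof.
move=> mf dF cf Fc fc; have fi := gauss2_integrable_dominated mf fc.
split => //; rewrite /plane -integral21_prod_meas1//.
rewrite integral0_eq// => y _; rewrite /fubini_G.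
suff [_ ->] : has_rint lam (fun x => f (x, y)) 0 by [].
apply: (has_rint_half_gauss_derive (dF ^~ y) (cf y)
  (c := c * expR (- (y ^+ 2) / 2)) (c' := c' * expR (- (y ^+ 2) / 2))) => x.
  by apply: le_trans (Fc (x, y)) _; rewrite gauss2_split mulrCA mulrC.
by apply: le_trans (fc (x, y)) _; rewrite gauss2_split mulrCA mulrC.
Qed.

Lemma has_rint_plane_dy (F f : T * T -> R) (c c' : R) :
  measurable_fun [set: T * T] f ->
  (forall x y : R, is_derive y 1 (fun t => F (x, t)) (f (x, y))) ->
  (forall x, continuous (fun y : R => f (x, y) : R^o)) ->
  (forall z, `|F z| <= c * gauss2 z.1 z.2) ->
  (forall z, `|f z| <= c' * gauss2 z.1 z.2) ->
  has_rint plane f 0.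
Proof.
move=> mf dF cf Fc fc; have fi := gauss2_integrable_dominated mf fc.
split => //; rewrite /plane -integral12_prod_meas1//.
rewrite integral0_eq// => x _; rewrite /fubini_F.
suff [_ ->] : has_rint lam (fun y => f (x, y)) 0 by [].
apply: (has_rint_half_gauss_derive (dF x) (cf x)
  (c := c * expR (- (x ^+ 2) / 2)) (c' := c' * expR (- (x ^+ 2) / 2))) => y.
  by apply: le_trans (Fc (x, y)) _; rewrite gauss2_split mulrA.
by apply: le_trans (fc (x, y)) _; rewrite gauss2_split mulrA.
Qed.

(** The weight that the twisted product of two Gaussians produces, with alpha the
    conjugate of the point at which the product is evaluated. *)
Definition gweight alpha (w : C) : C := cexp (alpha * w - w * w^*).

(** Uniformity in alpha is what allows differentiation in alpha under the integral
    sign. *)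
Lemma gweight_dominated f (A : R) : tame f -> 0 <= A -> exists c : R,
  forall alpha, normc alpha <= A -> forall x y : R,
  normc (gweight alpha (x +i* y) * f (x +i* y)) <= c * gauss2 x y.
Proof.
move=> tf A0; have [c [a [c0 a0 hf]]] := tame_growth tf.
exists (c * expR ((A + a) ^+ 2 / 2)) => alpha hA x y.
set w := x +i* y; rewrite normcM normc_cexp.
apply: le_trans (ler_wpM2l (expR_ge0 _) (hf w)) _.
rewrite mulrCA -mulrA ler_wpM2l// -!expRD ler_expR.
have hw : normc w ^+ 2 = x ^+ 2 + y ^+ 2 by rewrite sqr_normcE.
have -> : Re (alpha * w - w * w^*) = Re (alpha * w) - normc w ^+ 2.
  by rewrite hw raddfB /= mulrN opprK !expr2.
have h1 : Re (alpha * w) <= A * normc w.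
  apply: le_trans (ler_norm _) _; apply: le_trans (Re_le_normc _) _.
  by rewrite normcM ler_wpM2r ?normc_ge0.
(* The quadratic exponent loses half of itself to absorb the linear one:
   (A + a) |w| <= |w|^2 / 2 + (A + a)^2 / 2. *)
rewrite -hw; have := sqr_ge0 (normc w - (A + a)); nra.
Qed.

Lemma tame_cmeasurable_gweight alpha f : tame f ->
  cmeasurable (fun z => gweight alpha (plane_point z) * f (plane_point z)).
Proof.
move=> tf; apply: cmeasurableM; last exact: tame_measurable.
apply: cmeasurable_cexp; apply: cmeasurableD.
  apply: cmeasurableM; last exact: (tame_measurable tame_id).
  by split; exact: measurable_cst.
have h : tame (fun w : C => -1 * (w * w^*)).
  by apply: tameM; [exact: tame_cst|apply: tameM; [exact: tame_id|exact: tame_conj]].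
by have := tame_measurable h; congr cmeasurable; apply/funext => z; rewrite mulN1r.
Qed.

Definition gint alpha f : C :=
  (\int[plane]_z Re (gweight alpha (plane_point z) * f (plane_point z))) +i*
  (\int[plane]_z Im (gweight alpha (plane_point z) * f (plane_point z))).

Lemma has_cint_gint alpha f : tame f ->
  has_cint plane (fun z => gweight alpha (plane_point z) * f (plane_point z))
    (gint alpha f).
Proof.
move=> tf; have [mR mI] := tame_cmeasurable_gweight alpha tf.
have [c hc] := gweight_dominated tf (normc_ge0 alpha).
split; apply: integrable_has_rint.
  by apply: (gauss2_integrable_dominated mR) => z;
    apply: le_trans (Re_le_normc _) (hc _ (lexx _) z.1 z.2).
by apply: (gauss2_integrable_dominated mI) => z;
  apply: le_trans (Im_le_normc _) (hc _ (lexx _) z.1 z.2).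
Qed.

Lemma eq_gint alpha f g : f =1 g -> gint alpha f = gint alpha g.
Proof. by move=> /funext ->. Qed.

Lemma gintD alpha f g : tame f -> tame g ->
  gint alpha (fun w => f w + g w) = gint alpha f + gint alpha g.
Proof.
move=> tf tg.
apply: has_cint_unique (has_cint_gint alpha (tameD tf tg)) _.
have := has_cintD (has_cint_gint alpha tf) (has_cint_gint alpha tg).
by apply: has_cint_ext => z; rewrite mulrDr.
Qed.

Lemma gintZ alpha c f : tame f ->
  gint alpha (fun w => c * f w) = c * gint alpha f.
Proof.
move=> tf.
apply: has_cint_unique (has_cint_gint alpha (tameM (tame_cst c) tf)) _.
have := has_cintZ c (has_cint_gint alpha tf).
by apply: has_cint_ext => z; rewrite mulrCA.
Qed.

Lemma is_cderive_gweight_x alpha x y :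
  is_cderive (fun t : R => gweight alpha (t +i* y)) x
   ((alpha - (x +i* y)^* - (x +i* y)) * gweight alpha (x +i* y)).
Proof.
have h := wirtingerD (wirtingerM (wirtinger_cst alpha) wirtinger_id)
  (wirtingerM (wirtinger_cst (-1)) (wirtingerM wirtinger_id (@wirtinger_conj R))).
have := is_cderive_cexp (wirtinger_dx h x y).
rewrite /gweight !mulN1r; set c := (X in is_cderive _ _ (X * _)).
rewrite (_ : c = alpha - (x +i* y)^* - (x +i* y)); last by rewrite /c; ring.
by apply: is_cderive_ext => t; rewrite mulN1r.
Qed.

Lemma is_cderive_gweight_y alpha x y :
  is_cderive (fun t : R => gweight alpha (x +i* t)) y
   ('i * (alpha - (x +i* y)^* + (x +i* y)) * gweight alpha (x +i* y)).
Proof.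
have h := wirtingerD (wirtingerM (wirtinger_cst alpha) wirtinger_id)
  (wirtingerM (wirtinger_cst (-1)) (wirtingerM wirtinger_id (@wirtinger_conj R))).
have := is_cderive_cexp (wirtinger_dy h x y).
rewrite /gweight !mulN1r; set c := (X in is_cderive _ _ (X * _)).
rewrite (_ : c = 'i * (alpha - (x +i* y)^* + (x +i* y))); last by rewrite /c; ring.
by apply: is_cderive_ext => t; rewrite mulN1r.
Qed.

Lemma tame_ext f g : f =1 g -> tame f -> tame g.
Proof. by move=> /funext ->. Qed.

Lemma tameN f : tame f -> tame (fun w => - f w).
Proof.
move=> tf; apply: tame_ext (tameM (tame_cst (-1)) tf) => w.
by rewrite mulN1r.
Qed.

Lemma gintN alpha f : tame f -> gint alpha (fun w => - f w) = - gint alpha f.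
Proof.
move=> tf; rewrite -mulN1r -gintZ//; apply: eq_gint => w; by rewrite mulN1r.
Qed.

Lemma ccontinuous_gweight_x alpha y :
  ccontinuous (fun x : R => gweight alpha (x +i* y)).
Proof. exact: is_cderive_ccontinuous (fun x => is_cderive_gweight_x alpha x y). Qed.

Lemma ccontinuous_gweight_y alpha x :
  ccontinuous (fun y : R => gweight alpha (x +i* y)).
Proof. exact: is_cderive_ccontinuous (is_cderive_gweight_y alpha x). Qed.

(** The integrand, times the weight, is the derivative along the real axis of the
    weight times f. *)
Lemma gint_dx alpha f fz fzb : wirtinger f fz fzb ->
  gint alpha (fun w => fz w + fzb w + (alpha - w^* - w) * f w) = 0.
Proof.
move=> [tf tz tzb dx dy]; set H := (X in gint _ X).
have tH : tame H.
  apply: tameD; first exact: tameD.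
  apply: tameM => //; apply: tameD; last exact/tameN/tame_id.
  by apply: tameD; [exact: tame_cst|exact/tameN/tame_conj].
have [mR mI] := tame_cmeasurable_gweight alpha tH.
have [c hc] := gweight_dominated tf (normc_ge0 alpha).
have [c' hc'] := gweight_dominated tH (normc_ge0 alpha).
have cH y := ccontinuousM (ccontinuous_gweight_x alpha y) (tame_continuous_x tH y).
have dF x y : is_cderive (fun t : R => gweight alpha (t +i* y) * f (t +i* y)) x
    (gweight alpha (x +i* y) * H (x +i* y)).
  have := is_cderiveM (is_cderive_gweight_x alpha x y) (dx x y).
  by congr is_cderive; rewrite /H; ring.
apply: has_cint_unique (has_cint_gint alpha tH) _; split.
  apply: (@has_rint_plane_dx
    (fun z => Re (gweight alpha (plane_point z) * f (plane_point z))) _ c c' mR).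
  - by move=> x y; have [] := dF x y.
  - by move=> y; have [] := cH y.
  - by move=> z; apply: le_trans (Re_le_normc _) (hc _ (lexx _) z.1 z.2).
  - by move=> z; apply: le_trans (Re_le_normc _) (hc' _ (lexx _) z.1 z.2).
apply: (@has_rint_plane_dx
  (fun z => Im (gweight alpha (plane_point z) * f (plane_point z))) _ c c' mI).
- by move=> x y; have [] := dF x y.
- by move=> y; have [] := cH y.
- by move=> z; apply: le_trans (Im_le_normc _) (hc _ (lexx _) z.1 z.2).
- by move=> z; apply: le_trans (Im_le_normc _) (hc' _ (lexx _) z.1 z.2).
Qed.

(** Up to a factor 'i, the integrand, times the weight, is the derivative along the
    imaginary axis of the weight times f. *)
Lemma gint_dy alpha f fz fzb : wirtinger f fz fzb ->
  gint alpha (fun w => fz w - fzb w + (alpha - w^* + w) * f w) = 0.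
Proof.
move=> [tf tz tzb dx dy]; set H0 := (X in gint _ X).
have tH0 : tame H0.
  apply: tameD; first by apply: tameD => //; exact: tameN.
  apply: tameM => //; apply: tameD; last exact: tame_id.
  by apply: tameD; [exact: tame_cst|exact/tameN/tame_conj].
pose H w := 'i * H0 w.
have tH : tame H by apply: tameM => //; exact: tame_cst.
suff : gint alpha H = 0.
  rewrite gintZ// => /eqP; rewrite mulf_eq0 => /orP[|/eqP//].
  by rewrite eq_complex /= oner_eq0 andbF.
have [mR mI] := tame_cmeasurable_gweight alpha tH.
have [c hc] := gweight_dominated tf (normc_ge0 alpha).
have [c' hc'] := gweight_dominated tH (normc_ge0 alpha).
have cH y := ccontinuousM (ccontinuous_gweight_y alpha y) (tame_continuous_y tH y).
have dF x y : is_cderive (fun t : R => gweight alpha (x +i* t) * f (x +i* t)) y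
    (gweight alpha (x +i* y) * H (x +i* y)).
  have := is_cderiveM (is_cderive_gweight_y alpha x y) (dy x y).
  by congr is_cderive; rewrite /H /H0; ring.
apply: has_cint_unique (has_cint_gint alpha tH) _; split.
  apply: (@has_rint_plane_dy
    (fun z => Re (gweight alpha (plane_point z) * f (plane_point z))) _ c c' mR).
  - by move=> x y; have [] := dF x y.
  - by move=> y; have [] := cH y.
  - by move=> z; apply: le_trans (Re_le_normc _) (hc _ (lexx _) z.1 z.2).
  - by move=> z; apply: le_trans (Re_le_normc _) (hc' _ (lexx _) z.1 z.2).
apply: (@has_rint_plane_dy
  (fun z => Im (gweight alpha (plane_point z) * f (plane_point z))) _ c c' mI).
- by move=> x y; have [] := dF x y.
- by move=> y; have [] := cH y.
- by move=> z; apply: le_trans (Im_le_normc _) (hc _ (lexx _) z.1 z.2).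
- by move=> z; apply: le_trans (Im_le_normc _) (hc' _ (lexx _) z.1 z.2).
Qed.

Lemma gint_dxdy_expand alpha f fz fzb : wirtinger f fz fzb ->
  gint alpha fz + gint alpha fzb + alpha * gint alpha f
    - gint alpha (fun w => w^* * f w) - gint alpha (fun w => w * f w) = 0 /\
  gint alpha fz - gint alpha fzb + alpha * gint alpha f
    - gint alpha (fun w => w^* * f w) + gint alpha (fun w => w * f w) = 0.
Proof.
move=> hf; have [tf tz tzb _ _] := hf.
have taf : tame (fun w => alpha * f w) by apply: tameM => //; exact: tame_cst.
have tcf : tame (fun w => w^* * f w) by apply: tameM => //; exact: tame_conj.
have tif : tame (fun w => w * f w) by apply: tameM => //; exact: tame_id.
have tNc := tameN tcf; have tNi := tameN tif; have tNzb := tameN tzb.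
have t1 := tameD tz tzb; have t2 := tameD t1 taf; have t3 := tameD t2 tNc.
have u1 := tameD tz tNzb; have u2 := tameD u1 taf; have u3 := tameD u2 tNc.
split.
  rewrite -(gint_dx alpha hf) -gintZ// -!gintN// -!gintD//.
  by apply: eq_gint => w; ring.
rewrite -(gint_dy alpha hf) -gintZ// -!gintN// -!gintD//.
by apply: eq_gint => w; ring.
Qed.

(** The weight is exp (alpha w - w conj w), whose derivative in conj w is - w times
    itself: integrate the derivative of its product with f. *)
Lemma gint_mul_id alpha f fz fzb : wirtinger f fz fzb ->
  gint alpha (fun w => w * f w) = gint alpha fzb.
Proof.
move=> /(gint_dxdy_expand alpha)[e1 e2]; apply/eqP; rewrite -subr_eq0.
have n2 : (2 : C) != 0 by rewrite pnatr_eq0.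
rewrite -(mulrI_eq0 _ (mulfI n2)); apply/eqP.
by rewrite -[RHS](subr0 0) -[X in _ = X - _]e2 -[X in _ = _ - X]e1; ring.
Qed.

(** Likewise for the derivative in w, which multiplies the weight by
    alpha - conj w. *)
Lemma gint_mul_conj alpha f fz fzb : wirtinger f fz fzb ->
  gint alpha (fun w => w^* * f w) = gint alpha fz + alpha * gint alpha f.
Proof.
move=> hf; have [+ _] := gint_dxdy_expand alpha hf.
rewrite (gint_mul_id alpha hf) => e.
by apply/eqP; rewrite eq_sym -subr_eq0 -e; apply/eqP; ring.
Qed.

Lemma gint_const0 alpha : gint alpha (fun=> 0) = 0.
Proof.
rewrite -[RHS](mul0r (gint alpha (fun=> 0))) -gintZ; last exact: tame_cst.
by apply: eq_gint => w; rewrite mul0r.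
Qed.

Lemma gint_id alpha : gint alpha id = 0.
Proof.
rewrite -[RHS](gint_const0 alpha) -(gint_mul_id alpha (wirtinger_cst 1)).
by apply: eq_gint => w; rewrite mulr1.
Qed.

Lemma is_cderive_gweight_scale alpha w (t : R) :
  is_cderive (fun s : R => gweight (s%:C * alpha) w) t
    (gweight (t%:C * alpha) w * (alpha * w)).
Proof.
have id1 : is_cderive (fun s : R => s%:C) t 1.
  by split => /=; [exact: is_derive_id|exact: is_derive_cst].
have h := is_cderiveD (is_cderiveM id1 (is_cderive_cst (alpha * w) t))
  (is_cderive_cst (- (w * w^*)) t).
have := is_cderive_cexp h; rewrite /gweight mulrA mulr0 !addr0 mul1r.
rewrite [_ * cexp _]mulrC -[t%:C * alpha * w]mulrA.
by apply: is_cderive_ext => s; rewrite mulrA.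
Qed.

Lemma normc_real (t : R) : normc t%:C = `|t|.
Proof. by rewrite /= expr0n addr0 sqrtr_sqr. Qed.

(** Differentiation under the integral brings out the factor alpha w, whose integral
    vanishes because multiplication by w is a derivative in conj w. *)
Lemma is_cderive_gint_scale alpha (t : R) :
  is_cderive (fun s : R => gint (s%:C * alpha) (fun=> 1)) t 0.
Proof.
pose I : set R := `]t - 1, t + 1[%classic.
have It : I t by rewrite /I /= in_itv /=; apply/andP; split; lra.
have t1 : tame (fun _ : C => 1 : C) by exact: tame_cst.
have ta : tame (fun w : C => alpha * w).
  by apply: tameM; [exact: tame_cst|exact: tame_id].
have E0 : gint (t%:C * alpha) (fun w => alpha * w) = 0.
  by rewrite gintZ ?gint_id ?mulr0//; exact: tame_id.
have A0 : 0 <= (`|t| + 1) * normc alpha.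
  by rewrite mulr_ge0 ?normc_ge0// addr_ge0.
have [c hc] := gweight_dominated ta A0.
have bound s : I s -> normc (s%:C * alpha) <= (`|t| + 1) * normc alpha.
  rewrite /I /= in_itv /= => /andP[s1 s2]; rewrite normcM normc_real.
  rewrite ler_wpM2r ?normc_ge0// ler_norml; have := ler_norm t.
  have := ler_norm (- t); rewrite normrN => ? ?; apply/andP; split; lra.
have c0 (z : T * T) : 0 <= c * gauss2 z.1 z.2.
  exact: le_trans (normc_ge0 _) (hc _ (bound _ It) z.1 z.2).
have G_int : plane.-integrable setT (EFin \o (fun z => c * gauss2 z.1 z.2)).
  exact: (integrableZl measurableT c (@integrable_gauss2 R)).
have dcomp (p : C -> R)
    (F := fun (s : R) (z : T * T) => p (gweight (s%:C * alpha) (plane_point z))) :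
    (forall s, plane.-integrable setT (EFin \o F s)) ->
    (forall (s : R) z, is_derive s 1 (F ^~ z)
      (p (gweight (s%:C * alpha) (plane_point z) * (alpha * plane_point z)))) ->
    (forall w, `|p w| <= normc w) ->
    (\int[plane]_z
       p (gweight (t%:C * alpha) (plane_point z) * (alpha * plane_point z)) = 0) ->
    is_derive t 1 (fun s => \int[plane]_z F s z) 0.
  move=> Fi dF pn p0.
  have E s z : partial1of2 F s z =
      p (gweight (s%:C * alpha) (plane_point z) * (alpha * plane_point z)).
    by rewrite partial1of2E; have [_ ->] := dF s z.
  have bd s z : I s -> setT z -> `|partial1of2 F s z| <= c * gauss2 z.1 z.2.
    move=> Is _; rewrite E; apply: le_trans (pn _) _.
    exact: hc (bound _ Is) z.1 z.2.
  have d1 s z : I s -> setT z -> derivable (F ^~ z) s 1.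
    by move=> _ _; have [] := dF s z.
  have Fi' s (_ : I s) := Fi s.
  have dI := derivable_under_integral measurableT It Fi' d1 c0 G_int bd.
  split => //; rewrite -derive1E.
  rewrite (differentiation_under_integral measurableT It Fi' d1 c0 G_int bd).
  by rewrite -[RHS]p0; apply: eq_Rintegral => z _; rewrite E.
have [[_ IR] [_ II]] := has_cint_gint (t%:C * alpha) ta.
rewrite E0 in IR II.
split.
  rewrite (_ : (fun _ => _) = fun s : R =>
      \int[plane]_z Re (gweight (s%:C * alpha) (plane_point z))); last first.
    by apply/funext => s; apply: eq_Rintegral => z _; rewrite mulr1.
  apply: (dcomp Re).
  - move=> s; have [[fi _] _] := has_cint_gint (s%:C * alpha) t1.
    by apply: eq_integrable fi => // z _; rewrite /comp mulr1.
  - by move=> s z; have [] := is_cderive_gweight_scale alpha (plane_point z) s.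
  - exact: Re_le_normc.
  - by rewrite /Rintegral IR.
rewrite (_ : (fun _ => _) = fun s : R =>
    \int[plane]_z Im (gweight (s%:C * alpha) (plane_point z))); last first.
  by apply/funext => s; apply: eq_Rintegral => z _; rewrite mulr1.
apply: (dcomp Im).
- move=> s; have [_ [fi _]] := has_cint_gint (s%:C * alpha) t1.
  by apply: eq_integrable fi => // z _; rewrite /comp mulr1.
- by move=> s z; have [] := is_cderive_gweight_scale alpha (plane_point z) s.
- exact: Im_le_normc.
- by rewrite /Rintegral II.
Qed.

Lemma gint0_cst1 : gint 0 (fun=> 1) = pi%:C.
Proof.
have hg : has_cint lam (fun x : T => (gauss_fun x)%:C) (Num.sqrt pi)%:C.
  split => /=; first by split; [exact: integrableT_gauss|exact: integralT_gauss].
  by split; [exact: integrable0|rewrite integral0].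
have := has_cint_prod hg hg; rewrite -rmorphM -expr2 sqr_sqrtr ?pi_ge0//.
apply: has_cint_unique.
have := has_cint_gint 0 (tame_cst 1); apply: has_cint_ext => z.
rewrite mulr1 /gweight mul0r sub0r /plane_point -rmorphM /gauss_fun -expRD.
have -> : - ((z.1 +i* z.2) * (z.1 +i* z.2)^*) = (- z.1 ^+ 2 - z.2 ^+ 2)%:C.
  by apply/eqP; rewrite eq_complex /= !expr2; apply/andP; split; apply/eqP; ring.
by rewrite cexpE /= cos0 sin0 mulr1 mulr0.
Qed.

(** Moving alpha along the ray from 0 does not change the total mass, and at 0 the
    weight is a product of two real Gaussians. *)
Lemma gint_cst1 alpha : gint alpha (fun=> 1) = pi%:C.
Proof.
rewrite -gint0_cst1 -[in LHS](mul1r alpha) -[1 * alpha]/(1%:C * alpha).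
rewrite -[in RHS](mul0r alpha) -[0 * alpha]/(0%:C * alpha).
have h := is_cderive_gint_scale alpha.
apply/eqP; rewrite eq_complex; apply/andP; split; apply/eqP.
  exact: (is_derive_0_is_cst (f := fun s => Re (gint (s%:C * alpha) (fun=> 1)))
    _ _ (fun s => (h s).1)).
exact: (is_derive_0_is_cst (f := fun s => Im (gint (s%:C * alpha) (fun=> 1)))
  _ _ (fun s => (h s).2)).
Qed.

End GaussianIntegral.

(** * Laguerre polynomials from their generating function *)

Section Laguerre.
Context {R : realType}.
Implicit Types (s z : R).

Definition laguerre_poly (k p : nat) s : R :=
  \sum_(l < k.+1) (- s) ^+ l * 'C(k + p, k - l)%:R / (l`!)%:R.

Definition negbin (m n : nat) z : R := \sum_(j < n) 'C(j + m, j)%:R * z ^+ j.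

(** Pascal's rule, summed: dividing by 1 - z raises m up to a boundary term, which
    gives the bound and the limit below by induction on m. *)
Lemma negbin_step m n z :
  (1 - z) * negbin m.+1 n.+1 z = negbin m n.+1 z - 'C(n + m.+1, n)%:R * z ^+ n.+1.
Proof.
elim: n => [|n IH]; first by rewrite /negbin !big_ord1 /= !bin0; ring.
rewrite /negbin big_ord_recr [in RHS]big_ord_recr /= mulrDr.
rewrite -/(negbin m.+1 n.+1 z) -/(negbin m n.+1 z) IH.
have -> : 'C(n.+1 + m.+1, n.+1) = ('C(n.+1 + m, n.+1) + 'C(n + m.+1, n))%N.
  by rewrite addSn binS -addSnnS.
rewrite natrD !exprS; ring.
Qed.

Lemma negbin_le m n z : 0 <= z < 1 -> negbin m n z <= (1 - z) ^- m.+1.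
Proof.
move=> /andP[z0 z1]; have z1' : 0 < 1 - z by rewrite subr_gt0.
elim: m n => [|m IH] n.
  rewrite expr1 -[leRHS]mul1r ler_pdivlMr//.
  rewrite (_ : negbin 0 n z = \sum_(j < n) z ^+ j); last first.
    by apply: eq_bigr => j _; rewrite addn0 binn mul1r.
  rewrite mulrC -[1 - z]opprB mulNr -subrX1 opprB.
  by rewrite gerBl exprn_ge0.
case: n => [|n]; first by rewrite /negbin big_ord0 invr_ge0 exprn_ge0// ltW.
rewrite exprSr invfM -[leRHS]mulrC -ler_pdivrMl ?invr_gt0// invrK negbin_step.
apply: le_trans (IH n.+1); rewrite gerBl mulr_ge0 ?exprn_ge0//.
Qed.

Lemma norm_negbin_le m n z : `|z| < 1 -> `|negbin m n z| <= (1 - `|z|) ^- m.+1.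
Proof.
move=> z1; apply: le_trans (negbin_le m n _); last by rewrite normr_ge0.
apply: le_trans (ler_norm_sum _ _ _) _; apply: ler_sum => j _.
by rewrite normrM normrX normr_nat.
Qed.

(** The terms tend to 0 since their partial sums are bounded. *)
Lemma bin_expr_cvg0 m z : `|z| < 1 ->
  'C(n + m, n)%:R * z ^+ n @[n --> \oo] --> 0.
Proof.
move=> z1; apply: norm_cvg0.
have -> : (fun n => `|'C(n + m, n)%:R * z ^+ n|) =
    (fun n => 'C(n + m, n)%:R * `|z| ^+ n).
  by apply/funext => n; rewrite normrM normrX normr_nat.
apply: cvg_series_cvg_0.
apply: nondecreasing_is_cvgn.
  apply/nondecreasing_seqP => n; rewrite /series /= big_nat_recr//= lerDl.
  by rewrite mulr_ge0 ?exprn_ge0.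
exists ((1 - `|z|) ^- m.+1) => _ [n _ <-]; rewrite /series /= big_mkord.
by apply: negbin_le; rewrite normr_ge0.
Qed.

Lemma cvg_negbin m z : `|z| < 1 -> negbin m n z @[n --> \oo] --> (1 - z) ^- m.+1.
Proof.
move=> z1; have z1' : 1 - z != 0.
  by rewrite subr_eq0; apply: contraTneq z1 => <-; rewrite normr1 ltxx.
elim: m => [|m IH].
  rewrite expr1.
  rewrite (_ : negbin 0 ^~ z = series (geometric 1 z)); last first.
    apply/funext => n; rewrite /series /= big_mkord; apply: eq_bigr => j _.
    by rewrite addn0 binn.
  by have := @cvg_geometric_series R 1 z z1; rewrite mul1r.
rewrite -(cvg_shiftS _) /=.
have -> : (fun n => negbin m.+1 n.+1 z) =
  fun n => (1 - z)^-1 * (negbin m n.+1 z - 'C(n + m.+1, n)%:R * z ^+ n * z).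
  by apply/funext => n; rewrite -mulrA -exprSr -negbin_step mulKf.
have -> : (1 - z) ^- m.+2 = (1 - z)^-1 * ((1 - z) ^- m.+1 - 0 * z).
  by rewrite mul0r subr0 exprS invfM.
apply: cvgMr; apply: cvgB; first by move: IH; rewrite -(cvg_shiftS _).
by apply: cvgMl; exact: bin_expr_cvg0.
Qed.

(** Tannery's theorem, in the form for triangular arrays that a double series summed
    by antidiagonals calls for. *)
Lemma cvg_tannery (u : nat -> nat -> R) (v g : nat -> R) (L : R) :
  (forall l, u n l @[n --> \oo] --> v l) ->
  (forall n l, `|u n l| <= g l) ->
  cvgn (series g) -> series v @ \oo --> L ->
  \sum_(l < n) u n l @[n --> \oo] --> L.
Proof.
move=> uv ug /cvg_ex[/= G cg] vL; apply/cvgrPdist_le => /= e e0.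
have e4 : 0 < e / 4 by rewrite divr_gt0.
have [N [Nv NG]] : exists N, `|L - series v N| <= e / 4 /\
    forall n, (N <= n)%N -> `|G - series g n| <= e / 4.
  have /cvgrPdist_le/(_ _ e4)[N1 _ h1] := vL.
  have /cvgrPdist_le/(_ _ e4)[N2 _ h2] := cg.
  exists (maxn N1 N2); split; first exact/h1/leq_maxl.
  by move=> n hn; apply: h2; exact: leq_trans (leq_maxr _ _) hn.
have : \sum_(l < N) u n l @[n --> \oo] --> series v N.
  rewrite /series /= big_mkord.
  apply: cvg_big => [|l _]; last exact: uv.
  exact: add_continuous.
move=> /cvgrPdist_le/(_ _ e4) uN; near=> n.
have Nn : (N <= n)%N by near: n; exact: nbhs_infty_ge.
have hn : `|series v N - \sum_(l < N) u n l| <= e / 4 by near: n.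
have hg : `|\sum_(l < n) u n l - \sum_(l < N) u n l| <= e / 2.
  rewrite -!(big_mkord xpredT) (big_cat_nat _ (n := N))//= addrAC subrr add0r.
  apply: le_trans (ler_norm_sum _ _ _) _.
  apply: (@le_trans _ _ (series g n - series g N)).
    rewrite /series /= [in leRHS](big_cat_nat _ (n := N))//= addrAC subrr add0r.
    exact: ler_sum.
  have := NG _ Nn; have := NG _ (leqnn N).
  rewrite !ler_norml => /andP[_ ?] /andP[? _]; lra.
rewrite ler_norml; move: Nv hn hg; rewrite !ler_norml.
by move=> /andP[? ?] /andP[? ?] /andP[? ?]; apply/andP; split; lra.
Unshelve. all: by end_near. Qed.

Lemma cvg_exp_series (x a : R) :
  series (fun l => x ^+ l / l`!%:R * a) @ \oo --> expR x * a.
Proof.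
have -> : series (fun l => x ^+ l / l`!%:R * a) =
    (fun n => series (exp_coeff x) n * a).
  by apply/funext => n; rewrite /series /= mulr_suml.
by apply: cvgMl; exact: is_cvg_series_exp_coeff.
Qed.

(** Both sides expand into the double series of
    (- s z)^l / l! C(j + l + p, j) z^j, summed by antidiagonals on the left and, on
    the right, first over j by the negative binomial series. *)
Lemma laguerre_generating_poly (p : nat) s :
  laguerre_generating p s (fun k => laguerre_poly k p s).
Proof.
move=> z z1; have nz0 : 0 < 1 - `|z| by rewrite subr_gt0.
have z1' : 1 - z != 0.
  by rewrite subr_eq0; apply: contraTneq z1 => <-; rewrite normr1 ltxx.
pose c (x : R) (l : nat) : R := x ^+ l / l`!%:R.
pose u (n l : nat) : R := c (- (s * z)) l * negbin (l + p) (n - l) z.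
have -> : series (fun k => laguerre_poly k p s * z ^+ k) =
    (fun n => \sum_(l < n) u n l).
  apply/funext => n; rewrite /series /= -(big_mkord xpredT (u n)).
  elim: n => [|n IH]; first by rewrite !big_geq.
  rewrite big_nat_recr//= IH [RHS]big_nat_recr//= /laguerre_poly.
  rewrite -(big_mkord xpredT (fun l => (- s) ^+ l * 'C(n + p, n - l)%:R / l`!%:R)).
  rewrite big_nat_recr//= mulrDl big_distrl /= addrA -big_split /=; congr (_ + _).
    apply: eq_big_nat => l /andP[_ ln]; rewrite /u subSn; last exact: ltnW.
    rewrite [in RHS]/negbin big_ord_recr /= -/(negbin (l + p) (n - l) z) mulrDr.
    congr (_ + _); rewrite addnA subnK; last exact: ltnW.
    rewrite /c -mulNr exprMn; have -> : z ^+ n = z ^+ l * z ^+ (n - l).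
      by rewrite -exprD subnKC// ltnW.
    by field; rewrite pnatr_eq0 -lt0n fact_gt0.
  rewrite /u subnn bin0 subSnn /negbin big_ord1 /= bin0 /c -mulNr exprMn; ring.
pose g (l : nat) := c (`|s * z| / (1 - `|z|)) l * (1 - `|z|) ^- p.+1.
apply: (@cvg_tannery _ (fun l => c (- (s * z)) l * (1 - z) ^- (l + p).+1) g).
- move=> l; apply: cvgMr; rewrite -(cvg_shiftn l).
  have -> : [sequence negbin (l + p) (n + l - l) z]_n = negbin (l + p) ^~ z.
    by apply/funext => n /=; rewrite addnK.
  exact: cvg_negbin.
- move=> n l; rewrite /u normrM /g.
  have -> : c (`|s * z| / (1 - `|z|)) l * (1 - `|z|) ^- p.+1 =
      `|c (- (s * z)) l| * (1 - `|z|) ^- (l + p).+1.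
    have -> : `|c (- (s * z)) l| = c `|s * z| l.
      by rewrite /c [LHS]normrM normfV normr_nat normrX normrN.
    by rewrite /c -addnS exprD exprMn exprVn invfM; ring.
  by rewrite ler_wpM2l// norm_negbin_le.
- apply/cvg_ex; eexists; exact: cvg_exp_series.
- have -> : (fun l => c (- (s * z)) l * (1 - z) ^- (l + p).+1) =
    (fun l => c (- (s * z / (1 - z))) l * (1 - z) ^- p.+1).
    apply/funext => l; rewrite /c -[- (_ / _)]mulNr exprMn exprVn.
    by rewrite -addnS exprD invfM; ring.
  by rewrite [(1 - z) ^- _ * _]mulrC; exact: cvg_exp_series.
Qed.

Lemma sum_expr_tail_le (x : R) (m n : nat) : 0 <= x <= 2^-1 ->
  \sum_(m <= k < n) x ^+ k <= 2 * x ^+ m.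
Proof.
move=> /andP[x0 x1]; have [nm|mn] := leqP n m.
  by rewrite big_geq// mulr_ge0// exprn_ge0.
have h : (1 - x) * \sum_(m <= k < n) x ^+ k = x ^+ m - x ^+ n.
  elim: n mn => // n IH; rewrite ltnS leq_eqVlt => /orP[/eqP <-|mn].
    by rewrite big_nat1 exprS; ring.
  rewrite big_nat_recr /=; last exact: ltnW.
    by rewrite mulrDr IH// exprS; ring.
have s0 : 0 <= \sum_(m <= k < n) x ^+ k.
  by rewrite sumr_ge0// => i _; rewrite exprn_ge0.
have xn : 0 <= x ^+ n by rewrite exprn_ge0.
by nra.
Qed.

(** Convergence at 1/2 bounds c k by a multiple of 2^k, so that if the coefficients
    below N vanish, |c N| is at most a constant times z for all small z. *)
Lemma power_series_coef_eq0 (c : nat -> R) :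
  (forall z : R, `|z| < 1 -> series (fun k => c k * z ^+ k) @ \oo --> 0) ->
  forall n, c n = 0.
Proof.
move=> h.
have [M M0 cM] : exists2 M, 0 <= M & forall k, `|c k| <= M * 2 ^+ k.
  have h2 : `|2^-1 : R| < 1 by rewrite ger0_norm// invf_lt1// ltr1n.
  have /cvg_series_cvg_0 c0 : cvgn (series (fun k => c k * 2^-1 ^+ k)).
    by apply/cvg_ex; exists 0; exact: h.
  have /cvg_seq_bounded/pinfty_ex_gt0[M M0 hM] : cvgn (fun k => c k * 2^-1 ^+ k).
    by apply/cvg_ex; exists 0.
  exists M; [exact: ltW|move=> k].
  have := hM k I; rewrite /= normrM exprVn normfV ler_pdivrMr; last first.
    by rewrite normr_gt0 expf_neq0.
  by rewrite [`|2 ^+ k|]ger0_norm ?exprn_ge0.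
elim/ltn_ind => N IH; apply/eqP; rewrite -normr_le0; apply/ler_addgt0Pl => /= e e0.
pose K := M * 2 ^+ N.+1 * 2; have K0 : 0 <= K by rewrite !mulr_ge0 ?exprn_ge0.
(* Below 1/4 the tail is at most K z times z^N; below e / (K + 1) that K z is at
   most e. *)
pose z : R := Num.min (4^-1) (e / (K + 1)).
have z0 : 0 < z by rewrite lt_min invr_gt0 divr_gt0//= ltr_wpDl.
have z4 : z <= 4^-1 by rewrite ge_min lexx.
have zK : z * K <= e.
  rewrite (@le_trans _ _ (z * (K + 1)))//.
    by apply: ler_wpM2l; [exact: ltW|rewrite lerDl].
  by rewrite -ler_pdivlMr ?ltr_wpDl// ge_min lexx orbT.
have z1 : `|z| < 1 by rewrite gtr0_norm//; lra.
have bound n : (N < n)%N ->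
    `|c N| * z ^+ N <= `|series (fun k => c k * z ^+ k) n| + K * z * z ^+ N.
  move=> Nn; have -> : series (fun k => c k * z ^+ k) n =
      c N * z ^+ N + \sum_(N.+1 <= k < n) c k * z ^+ k.
    rewrite /series /= (big_cat_nat _ (n := N))//=; last exact: ltnW.
    rewrite [X in X + _]big_nat [X in X + _]big1 ?add0r; first by rewrite big_ltn.
    by move=> i /andP[_ iN]; rewrite IH// mul0r.
  have tail : `|\sum_(N.+1 <= k < n) c k * z ^+ k| <= K * z * z ^+ N.
    apply: le_trans (ler_norm_sum _ _ _) _.
    apply: (@le_trans _ _ (M * \sum_(N.+1 <= k < n) (2 * z) ^+ k)).
      rewrite mulr_sumr; apply: ler_sum => k _.
      rewrite normrM normrX (gtr0_norm z0) exprMn mulrA.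
      by rewrite ler_wpM2r ?exprn_ge0// ltW.
    apply: le_trans (ler_wpM2l M0 (sum_expr_tail_le _ _ _)) _.
      by apply/andP; split; lra.
    rewrite [leLHS](_ : _ = K * z * z ^+ N)// /K exprMn !exprS; ring.
  have := ler_normB (c N * z ^+ N + \sum_(N.+1 <= k < n) c k * z ^+ k)
    (\sum_(N.+1 <= k < n) c k * z ^+ k).
  rewrite addrK normrM [`|z ^+ N|]ger0_norm => [H|]; last first.
    by apply: exprn_ge0; exact: ltW.
  by apply: le_trans H _; rewrite lerD2l.
have zN : 0 < z ^+ N by rewrite exprn_gt0.
have : `|c N| * z ^+ N <= 0 + K * z * z ^+ N.
  have lim : `|series (fun k => c k * z ^+ k) n| + K * z * z ^+ N @[n --> \oo]
      --> 0 + K * z * z ^+ N.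
    apply: cvgD; last exact: cvg_cst.
    by rewrite -(normr0 R); apply: cvg_norm; exact: h.
  rewrite -(cvg_lim _ lim)//; apply: limr_ge; first by apply/cvg_ex; eexists; exact: lim.
  by near=> n; apply: bound; near: n; exact: nbhs_infty_gt.
rewrite add0r ler_pM2r// => H; rewrite addr0; apply: le_trans H _.
by rewrite mulrC.
Unshelve. all: by end_near. Qed.

(** The sequence chosen by [laguerre] and the explicit one have the same generating
    function, hence the same coefficients. *)
Lemma laguerreE (k p : nat) s : laguerre k p s = laguerre_poly k p s.
Proof.
have hp : laguerre_generating p s (fun k => laguerre_poly k p s).
  exact: laguerre_generating_poly.
have ha : laguerre_generating p s (xget (fun=> 0) [set a | laguerre_generating p s a]).
  exact: (xgetPex (fun=> 0) (ex_intro _ _ hp)).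
apply/eqP; rewrite -subr_eq0; apply/eqP.
apply: (power_series_coef_eq0 (c := fun k => laguerre k p s - laguerre_poly k p s)).
move=> z z1; rewrite (_ : series _ = (series (fun k => laguerre k p s * z ^+ k)) -
  (series (fun k => laguerre_poly k p s * z ^+ k))).
  rewrite -[0](subrr ((1 - z) ^- p.+1 * expR (- (s * z / (1 - z))))).
  by apply: cvgB; [exact: ha|exact: hp].
apply/funext => n; rewrite !fctE /series /= -sumrB.
by apply: eq_bigr => i _; rewrite mulrBl.
Qed.

End Laguerre.

(** * Twisted convolution in one mode: complex Hermite polynomials *)

Section ComplexHermite.
Context {K : comNzRingType}.
Implicit Types (a b : nat) (U V : K).

(** The complex Hermite (Ito) polynomials: the coefficients of s^a t^b / (a! b!) in
    exp (s t + s U + t V), computed by differentiating in s. *)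
Fixpoint ito a b U V : K :=
  match a with
  | 0 => V ^+ b
  | a'.+1 => U * ito a' b U V + b%:R * ito a' b.-1 U V
  end.

Lemma itoSl a b U V :
  ito a.+1 b U V = U * ito a b U V + b%:R * ito a b.-1 U V.
Proof. by []. Qed.

(** The recursion obtained by differentiating the generating function in t instead. *)
Lemma itoSr a b U V :
  ito a b.+1 U V = V * ito a b U V + a%:R * ito a.-1 b U V.
Proof.
elim: a b => [|a IH] b; first by rewrite /= exprS mul0r addr0.
rewrite !itoSl IH /= -!natr1.
suff : a%:R * U * ito a.-1 b U V + b%:R * ito a b U V =
       V * b%:R * ito a b.-1 U V + a%:R * ito a b U V.
  by move/eqP; rewrite -subr_eq0 => /eqP h; apply/eqP; rewrite -subr_eq0;
    apply/eqP; rewrite -[RHS]h; ring.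
case: b => [|b] /=.
  rewrite !mul0r mulr0 mul0r addr0 add0r; case: (a) => [|a']; first by rewrite !mul0r.
  by rewrite itoSl mul0r addr0 mulrA.
rewrite [X in _ + _ * X = _]IH; case: (a) => [|a']; first by rewrite /= mul0r; ring.
rewrite [ito a'.+1 b.+1 _ _]itoSl /=; ring.
Qed.

Lemma ito_sym a b U V : ito a b U V = ito b a V U.
Proof.
elim: a b => [|a IH] b; last by rewrite itoSr itoSl !IH.
by elim: b => //= b IH; rewrite exprS -IH mul0r addr0.
Qed.

Lemma ito_sum a b U V :
  ito a b U V =
  \sum_(j < b.+1) (j`! * 'C(a, j) * 'C(b, j))%:R * U ^+ (a - j) * V ^+ (b - j).
Proof.
elim: a b => [|a IH] b.
  rewrite big_ord_recl big1 ?addr0 /= => [|j _]; last by rewrite muln0 !mul0r.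
  by rewrite !bin0 !subn0 expr0 mulr1 mul1r.
rewrite itoSl IH mulr_sumr.
have -> : b%:R * ito a b.-1 U V =
    \sum_(j < b.+1) (j`! * ((0 < j) * 'C(a, j.-1)) * 'C(b, j))%:R *
      U ^+ (a.+1 - j) * V ^+ (b - j).
  rewrite big_ord_recl /= mul0n muln0 mul0n !mul0r add0r.
  case: b => [|b]; first by rewrite big_ord0 mul0r.
  rewrite IH mulr_sumr; apply: eq_bigr => j _ /=.
  rewrite !mulrA -natrM /bump /= add1n subSS; congr (_%:R * _ * _).
  transitivity (j`! * 'C(a, j) * (b.+1 * 'C(b, j)))%N; first ring.
  by rewrite (mul_bin_diag b.+1 j) factS mul1n; ring.
rewrite -big_split; apply: eq_bigr => j _ /=.
have [ja|aj] := leqP j a.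
  rewrite subSn// exprS.
  have -> : 'C(a.+1, j) = ('C(a, j) + (0 < j) * 'C(a, j.-1))%N.
    by case: (nat_of_ord j) => [|i]; [rewrite !bin0|rewrite binS mul1n].
  by rewrite !natrM natrD natrM; ring.
rewrite [in X in _ * X + _](bin_small aj) muln0 mul0n !mul0r mulr0 add0r.
congr ((_ * _ * _)%:R * _ * _).
by case: (nat_of_ord j) aj => // i ai; rewrite mul1n binS (bin_small ai).
Qed.

End ComplexHermite.

Section LaguerreHermite.
Context {R : realType}.
Local Notation C := R[i].

(** With V = - conj u the product U V is - |u|^2, and reversing the order of summation
    turns one closed form into the other. *)
Lemma ito_laguerre (b p : nat) (u : C) :
  ito (b + p) b u (- u^*) =
  b`!%:R * u ^+ p * (laguerre_poly b p (Normc.normc u ^+ 2))%:C.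
Proof.
rewrite ito_sum /laguerre_poly rmorph_sum mulr_sumr (reindex_inj rev_ord_inj) /=.
apply: eq_bigr => l _; have lb : (l <= b)%N by rewrite -ltnS.
rewrite subSS (subKn lb) -addnBAC ?leq_subr// (subKn lb).
have e : ((Normc.normc u ^+ 2)%:C : C) = u * u^*.
  by rewrite sqr_normcE; case: u => x y; apply/eqP; rewrite eq_complex /=;
    apply/andP; split; apply/eqP; ring.
have -> : (((- Normc.normc u ^+ 2) ^+ l * 'C(b + p, b - l)%:R / l`!%:R)%:C : C) =
    (- (u * u^*)) ^+ l * 'C(b + p, b - l)%:R / l`!%:R.
  rewrite -e -(rmorph_nat (real_complex R)) -(rmorph_nat (real_complex R) l`!).
  by rewrite -fmorphV -rmorphN -rmorphXn -!rmorphM.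
have -> : b`!%:R = 'C(b, b - l)%:R * (l`!%:R * (b - l)`!%:R) :> C.
  by rewrite bin_sub// -!natrM bin_fact.
rewrite -mulrN exprMn exprD !natrM; field.
by rewrite pnatr_eq0 -lt0n fact_gt0.
Qed.

End LaguerreHermite.

Section TwistedMoments.
Context {R : realType}.
Local Notation C := R[i].
Implicit Types (c s t u : C).

Lemma wirtinger_affine c s : wirtinger (fun w : C => c + s * w) (fun=> s) (fun=> 0).
Proof.
have := wirtingerD (wirtinger_cst c) (wirtingerM (wirtinger_cst s) wirtinger_id).
by apply: wirtinger_ext => w; ring.
Qed.

Lemma wirtinger_affine_conj c s :
  wirtinger (fun w : C => c + s * w^*) (fun=> 0) (fun=> s).
Proof.
have := wirtingerD (wirtinger_cst c) (wirtingerM (wirtinger_cst s) (@wirtinger_conj R)).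
by apply: wirtinger_ext => w; ring.
Qed.

Lemma wirtinger_ito c s c' t a b :
  wirtinger (fun w => ito a b (c + s * w) (c' + t * w^*))
    (fun w => s * a%:R * ito a.-1 b (c + s * w) (c' + t * w^*))
    (fun w => t * b%:R * ito a b.-1 (c + s * w) (c' + t * w^*)).
Proof.
elim: a b => [|a IH] b.
  elim: b => [|b IHb].
    by have := @wirtinger_cst R 1; apply: wirtinger_ext => w /=; rewrite ?expr0; ring.
  have := wirtingerM (wirtinger_affine_conj c' t) IHb.
  apply: wirtinger_ext => w /=; rewrite ?exprS; [by []|ring|].
  by case: b {IHb} => [|b] /=; rewrite ?exprS -?natr1; ring.
have := wirtingerD (wirtingerM (wirtinger_affine c s) (IH b))
  (wirtingerM (wirtinger_cst b%:R) (IH b.-1)).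
apply: wirtinger_ext => w.
- by rewrite itoSl.
- case: a {IH} => [|a]; first by rewrite /=; ring.
  by rewrite [in RHS]itoSl /= -[a.+2%:R]natr1; ring.
- case: b => [|b]; first by rewrite /=; ring.
  rewrite [in RHS]itoSl /= -[b.+1%:R]natr1; ring.
Qed.

Lemma wirtinger_ito_shift u a b :
  wirtinger (fun w => ito a b (u - w) (w^* - u^*))
    (fun w => - a%:R * ito a.-1 b (u - w) (w^* - u^*))
    (fun w => b%:R * ito a b.-1 (u - w) (w^* - u^*)).
Proof.
by apply: wirtinger_ext (wirtinger_ito u (-1) (- u^*) 1 a b) => w;
  rewrite !(mulN1r, mul1r) [- _ + _]addrC.
Qed.

Lemma wirtinger_ito_conj a b :
  wirtinger (fun w : C => ito a b w (- w^*))
    (fun w => a%:R * ito a.-1 b w (- w^*))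
    (fun w => - b%:R * ito a b.-1 w (- w^*)).
Proof.
by apply: wirtinger_ext (wirtinger_ito 0 1 0 (-1) a b) => w;
  rewrite !(mulN1r, mul1r, add0r).
Qed.

(** The twisted convolution at u of the Hermite polynomials with indices p, k and q, m,
    stripped of the Gaussian in u and of the normalizing constants. *)
Definition twisted_moment u p k q m : C :=
  gint u^* (fun w => ito p k (u - w) (w^* - u^*) * ito q m w (- w^*)).

Lemma tame_ito_prod u p k q m :
  tame (fun w => ito p k (u - w) (w^* - u^*) * ito q m w (- w^*)).
Proof.
apply: tameM; first exact: wirtinger_tame (wirtinger_ito_shift u p k).
exact: wirtinger_tame (wirtinger_ito_conj q m).
Qed.

(** Raising k brings out a factor conj w - conj u. Integration by parts turns conj w
    into conj u plus the derivative in w; the derivative of the first polynomial cancels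
    the second term of its recursion in k, and that of the second one lowers q. *)
Lemma twisted_momentS u p k q m :
  twisted_moment u p k.+1 q m = q%:R * twisted_moment u p k q.-1 m.
Proof.
have hA := wirtinger_ito_shift u p k; have hB := wirtinger_ito_conj q m.
have hAB := wirtingerM hA hB; have tAB := tame_ito_prod u p k q m.
have tA := tame_ito_prod u p.-1 k q m; have tB := tame_ito_prod u p k q.-1 m.
have tc : tame (fun w : C => w^* * (ito p k (u - w) (w^* - u^*) * ito q m w (- w^*))).
  by apply: tameM => //; exact: tame_conj.
have tz c f : tame f -> tame (fun w : C => c * f w : C).
  by move=> tf; apply: tameM => //; exact: tame_cst.
transitivity (gint u^* (fun w => w^* * (ito p k (u - w) (w^* - u^*) * ito q m w (- w^*)))
    + - u^* * twisted_moment u p k q m + p%:R * twisted_moment u p.-1 k q m).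
  rewrite /twisted_moment -!gintZ// -!gintD//; last 3 first.
  - by apply: tameD => //; exact: tz.
  - exact: tz.
  - exact: tz.
  by apply: eq_gint => w; rewrite itoSr; ring.
rewrite (gint_mul_conj _ hAB).
have -> : gint u^* (fun w => - p%:R * ito p.-1 k (u - w) (w^* - u^*) * ito q m w (- w^*)
     + ito p k (u - w) (w^* - u^*) * (q%:R * ito q.-1 m w (- w^*))) =
    - p%:R * twisted_moment u p.-1 k q m + q%:R * twisted_moment u p k q.-1 m.
  rewrite /twisted_moment -!gintZ// -!gintD//; [|exact: tz|exact: tz].
  by apply: eq_gint => w; ring.
by rewrite -/(twisted_moment u p k q m); ring.
Qed.

(** Raising q brings out a factor w, that is, a derivative in conj w, which the first
    polynomial, free of conj w when k = 0, does not feel; that of the second one cancels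
    the other term of its recursion in q. *)
Lemma twisted_moment0S u p q m : twisted_moment u p 0 q.+1 m = 0.
Proof.
have hA := wirtinger_ito_shift u p 0; have hB := wirtinger_ito_conj q m.
have hAB := wirtingerM hA hB; have tAB := tame_ito_prod u p 0 q m.
have tB := tame_ito_prod u p 0 q m.-1.
have ti : tame (fun w : C => w * (ito p 0 (u - w) (w^* - u^*) * ito q m w (- w^*))).
  by apply: tameM => //; exact: tame_id.
have tz c f : tame f -> tame (fun w : C => c * f w : C).
  by move=> tf; apply: tameM => //; exact: tame_cst.
transitivity (gint u^* (fun w => w * (ito p 0 (u - w) (w^* - u^*) * ito q m w (- w^*)))
    + m%:R * twisted_moment u p 0 q m.-1).
  rewrite /twisted_moment -!gintZ// -!gintD//; last exact: tz.
  by apply: eq_gint => w; rewrite itoSl; ring.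
rewrite (gint_mul_id _ hAB).
have -> : gint u^* (fun w => 0%:R * ito p 0.-1 (u - w) (w^* - u^*) * ito q m w (- w^*)
     + ito p 0 (u - w) (w^* - u^*) * (- m%:R * ito q m.-1 w (- w^*))) =
    - m%:R * twisted_moment u p 0 q m.-1.
  rewrite /twisted_moment -!gintZ//.
  by apply: eq_gint => w; ring.
by ring.
Qed.

(** Now both polynomials are monomials, and integration by parts reproduces the
    recursions of [ito] in p and m. *)
Lemma twisted_moment00 u p m :
  twisted_moment u p 0 0 m = pi%:C * ito p m u (- u^*).
Proof.
have tz c f : tame f -> tame (fun w : C => c * f w : C).
  by move=> tf; apply: tameM => //; exact: tame_cst.
elim: p m => [|p IH] m.
  elim: m => [|m IHm].
    rewrite /= expr0 mulr1 -(gint_cst1 u^*).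
    by apply: eq_gint => w /=; rewrite !expr0 mulr1.
  have hB := wirtinger_ito_conj 0 m; have tB := wirtinger_tame hB.
  have tc : tame (fun w : C => w^* * ito 0 m w (- w^*)).
    by apply: tameM => //; exact: tame_conj.
  transitivity (-1 * gint u^* (fun w => w^* * ito 0 m w (- w^*))).
    by rewrite -gintZ//; apply: eq_gint => w /=; rewrite expr0 exprS; ring.
  rewrite (gint_mul_conj _ hB).
  have -> : gint u^* (fun w : C => ito 0 m w (- w^*)) = pi%:C * ito 0 m u (- u^*).
    by rewrite -IHm; apply: eq_gint => w /=; rewrite expr0 mul1r.
  have -> : gint u^* (fun w : C => 0%:R * ito 0.-1 m w (- w^*)) = 0.
    by rewrite gintZ// mul0r.
  by rewrite /= exprS; ring.
have hA := wirtinger_ito_shift u p 0; have hB := wirtinger_ito_conj 0 m.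
have hAB := wirtingerM hA hB; have tAB := tame_ito_prod u p 0 0 m.
have tB := tame_ito_prod u p 0 0 m.-1.
have ti : tame (fun w : C => w * (ito p 0 (u - w) (w^* - u^*) * ito 0 m w (- w^*))).
  by apply: tameM => //; exact: tame_id.
transitivity (u * twisted_moment u p 0 0 m +
   -1 * gint u^* (fun w => w * (ito p 0 (u - w) (w^* - u^*) * ito 0 m w (- w^*)))).
  rewrite /twisted_moment -!gintZ// -!gintD//; [|exact: tz|exact: tz].
  by apply: eq_gint => w; rewrite itoSl; ring.
rewrite (gint_mul_id _ hAB).
have -> : gint u^* (fun w => 0%:R * ito p 0.-1 (u - w) (w^* - u^*) * ito 0 m w (- w^*)
     + ito p 0 (u - w) (w^* - u^*) * (- m%:R * ito 0 m.-1 w (- w^*))) =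
    - m%:R * twisted_moment u p 0 0 m.-1.
  rewrite /twisted_moment -!gintZ//.
  by apply: eq_gint => w; ring.
by rewrite !IH itoSl; ring.
Qed.

Lemma twisted_momentE u p k q m :
  twisted_moment u p k q m = (k == q)%:R * k`!%:R * pi%:C * ito p m u (- u^*).
Proof.
elim: k q => [|k IH] [|q].
- by rewrite twisted_moment00 fact0 !mul1r.
- by rewrite twisted_moment0S !mul0r.
- by rewrite twisted_momentS !mul0r.
- rewrite twisted_momentS IH eqSS factS natrM.
  by have [->|_] := eqVneq k q; rewrite ?mul0r ?mulr0// !mul1r !mulrA.
Qed.

End TwistedMoments.

(** * Exponential Laguerre functions as matrix units *)

Section MatrixUnits.
Context {R : realType}.
Local Notation C := R[i].
Local Notation normc := (@ComplexField.Normc.normc R).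
Implicit Types (u w x : C) (a b : nat).

(** The matrix units, up to a factor pi, of twisted convolution in one complex
    variable. *)
Definition hermite_fun a b u : C :=
  ((Num.sqrt (a`! * b`!)%:R)^-1)%:C * cexp (- (u * u^*) / 2) * ito a b u (- u^*).

Lemma mulc_conj u : u * u^* = (normc u ^+ 2)%:C.
Proof.
rewrite sqr_normcE; case: u => x y; apply/eqP; rewrite eq_complex /=.
by apply/andP; split; apply/eqP; ring.
Qed.

Lemma cexp_real (t : R) : cexp t%:C = (expR t)%:C.
Proof. by rewrite cexpE /= cos0 sin0 mulr1 mulr0. Qed.

Lemma expi_Im u : expi (complex.Im u) = cexp ((u - u^*) / 2).
Proof.
have -> : (u - u^*) / 2 = 0 +i* complex.Im u.
  case: u => x y; apply/eqP; rewrite eq_complex /=.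
  by apply/andP; split; apply/eqP; field.
by rewrite /cexp /= expR0 mul1r.
Qed.

(** Half of the cross terms of |u - w|^2 is cancelled by the oscillating factor: only
    the one holomorphic in w survives. *)
Lemma twisted_gauss u w :
  expi (complex.Im (u^* * w)) * cexp (- ((u - w) * (u - w)^*) / 2) *
  cexp (- (w * w^*) / 2) = cexp (- (u * u^*) / 2) * gweight u^* w.
Proof.
rewrite expi_Im /gweight -!cexpD; congr cexp.
have -> : (u^* * w)^* = u * w^* by rewrite (rmorphM (@conjc R)) /= conjcK.
by rewrite (rmorphB (@conjc R)) /=; field.
Qed.

Lemma has_cint_hermite_fun u a b c d :
  has_cint (@plane R)
    (fun z => expi (complex.Im (u^* * plane_point z)) *
       hermite_fun a b (u - plane_point z) * hermite_fun c d (plane_point z))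
    ((b == c)%:R * pi%:C * hermite_fun a d u).
Proof.
set s := fun e f : nat => Num.sqrt (e`! * f`!)%:R : R.
have s0 e f : s e f != 0 by rewrite sqrtr_eq0 -ltNge ltr0n muln_gt0 !fact_gt0.
have := has_cintZ (((s a b)^-1)%:C * ((s c d)^-1)%:C * cexp (- (u * u^*) / 2))
  (has_cint_gint u^* (tame_ito_prod u a b c d)).
rewrite -/(twisted_moment u a b c d) twisted_momentE.
have -> : ((s a b)^-1)%:C * ((s c d)^-1)%:C * cexp (- (u * u^*) / 2) *
    ((b == c)%:R * b`!%:R * pi%:C * ito a d u (- u^*)) =
    (b == c)%:R * pi%:C * hermite_fun a d u.
  have [bc|_] := eqVneq b c; last by rewrite !mul0r mulr0.
  rewrite /hermite_fun -/(s a d).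
  have -> : ((s a d)^-1)%:C = ((s a b)^-1)%:C * ((s c d)^-1)%:C * b`!%:R :> C.
    rewrite -(rmorph_nat (real_complex R)) -!rmorphM; congr (_%:C).
    rewrite -bc /s !natrM !sqrtrM ?ler0n//.
    have b2 : b`!%:R = Num.sqrt b`!%:R ^+ 2 :> R by rewrite sqr_sqrtr ?ler0n.
    rewrite [in X in _ = _ * X]b2; field.
    by rewrite !sqrtr_eq0 -!ltNge !ltr0n !fact_gt0.
  ring.
apply: has_cint_ext => z; set w := plane_point z.
rewrite -[LHS]mulrA [X in _ * X = _]mulrA.
rewrite -twisted_gauss /hermite_fun -/(s a b) -/(s c d).
have -> : - (u - w)^* = w^* - u^* by rewrite (rmorphB (@conjc R)) opprB.
ring.
Qed.

Lemma realCM (s t : R) : ((s * t)%:C : C) = s%:C * t%:C.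
Proof. exact: (rmorphM (real_complex R)). Qed.

Lemma realCX (s : R) n : ((s ^+ n)%:C : C) = s%:C ^+ n.
Proof. exact: (rmorphXn (real_complex R)). Qed.

(** For b <= a this is [ito_laguerre]; the other case follows from it by exchanging the
    two variables of [ito], at u' = - conj u, which accounts for the sign and for the
    negative power of the phase. *)
Lemma exp_laguerre1E r a b x (tau : 'cV[R]_r) :
  exp_laguerre1 (minn a b) (a%:Z - b%:Z) x tau =
  (2 * enorm tau / pi)%:C *
  hermite_fun a b ((Num.sqrt (2 * enorm tau))%:C * x).
Proof.
rewrite /exp_laguerre1; set t := 2 * enorm tau; set u := _ * x.
have t0 : 0 <= t by rewrite mulr_ge0// sqrtr_ge0.
have nx : `|x| = (normc x)%:C by rewrite normc_def; case: x {u}.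
have uE : t * complex.Re `|x| ^+ 2 = normc u ^+ 2.
  by rewrite nx /= /u normcM normc_real exprMn ger0_norm ?sqrtr_ge0// sqr_sqrtr.
have u1 : (normc u)%:C * (x / `|x|) = u.
  rewrite nx /u normcM normc_real ger0_norm ?sqrtr_ge0// rmorphM /= -mulrA.
  congr (_ * _).
  have [->|x0] := eqVneq x 0; first by rewrite mul0r mulr0.
  rewrite mulrCA divff ?mulr1//.
  by rewrite -nx normr_eq0.
have u2 : (normc u)%:C * (x / `|x|)^-1 = u^*.
  rewrite nx /u normcM normc_real ger0_norm ?sqrtr_ge0//.
  rewrite rmorphM (rmorphM (@conjc R)) /= oppr0 -mulrA.
  congr (_ * _); have [->|x0] := eqVneq x 0.
    by rewrite mul0r invr0 mulr0 (rmorph0 (@conjc R)).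
  rewrite invf_div mulrA.
  have -> : (normc x)%:C * (normc x)%:C = x * x^*.
    by rewrite mulc_conj expr2 (rmorphM (real_complex R)).
  by rewrite mulrC mulKf.
have pow (p : nat) : (normc u ^+ 2) `^ (p%:R / 2) = normc u ^+ p.
  rewrite -powR_mulrn ?normc_ge0// -powRrM mulrC -mulrA mulVf// mulr1.
  by rewrite powR_mulrn ?normc_ge0.
have cexpu : cexp (- (u * u^*) / 2) = (expR (- (normc u ^+ 2 / 2)))%:C.
  rewrite mulc_conj -cexp_real; congr cexp.
  by rewrite mulNr -(rmorph_nat (real_complex R)) -fmorphV -rmorphM -rmorphN.
have fact_sqrt (e p : nat) : Num.sqrt (e`!%:R / (e + p)`!%:R) =
    (Num.sqrt ((e + p)`! * e`!)%:R)^-1 * e`!%:R :> R.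
  rewrite natrM !sqrtrM ?ler0n// sqrtrV ?ler0n//.
  have e2 : e`!%:R = Num.sqrt e`!%:R ^+ 2 :> R by rewrite sqr_sqrtr ?ler0n.
  rewrite [in X in _ = _ * X]e2; field.
  by rewrite !sqrtr_eq0 -!ltNge !ltr0n !fact_gt0.
set e := x / `|x| in u1 u2 *.
have up (p : nat) : u ^+ p = (normc u)%:C ^+ p * e ^+ p by rewrite -exprMn u1.
have uNp (p : nat) : (- u^*) ^+ p = (-1) ^+ p * (normc u)%:C ^+ p * e^-1 ^+ p.
  by rewrite -mulrA -exprMn u2 -exprMn mulN1r.
rewrite uE; have [ba|ab] := leqP b a.
  have [p ->] : exists p, a = (b + p)%N by exists (a - b)%N; rewrite subnKC.
  rewrite (_ : (b + p)%N%:Z - b%:Z = p%:Z); last by rewrite PoszD addrAC subrr add0r.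
  have -> : (sgz p%:Z ^ p%:Z)%:~R = 1 :> C.
    by case: p => [|p]; rewrite ?expr0z// gtr0_sgz// exp1rz.
  rewrite absz_nat /laguerre_fun laguerreE pow /hermite_fun ito_laguerre.
  rewrite cexpu fact_sqrt.
  rewrite -exprnP -/e (up p) mulr1 -(rmorph_nat (real_complex R)).
  by rewrite !realCM realCX; ring.
have [p [p0 ->]] : exists p, (0 < p)%N /\ b = (a + p)%N.
  by exists (b - a)%N; rewrite subn_gt0 ab subnKC// ltnW.
rewrite (_ : a%:Z - (a + p)%N%:Z = - p%:Z); last by rewrite PoszD opprD addrA subrr add0r.
have -> : (sgz (- p%:Z) ^ (- p%:Z))%:~R = (-1) ^+ p :> C.
  rewrite sgzN gtr0_sgz// -invr_expz -exprnP -exprVn invrN1 rmorphXn /=.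
  by rewrite rmorphN rmorph1.
have uN : - (- u^*)^* = u by rewrite (rmorphN (@conjc R)) /= conjcK opprK.
have nuN : normc (- u^*) = normc u.
  rewrite -[- u^*]mulN1r normcM normc_conj /= !(oppr0, expr0n) sqrrN.
  by rewrite expr1n addr0 sqrtr1 mul1r.
rewrite abszN absz_nat /laguerre_fun laguerreE pow /hermite_fun ito_sym.
rewrite -[X in ito _ _ _ X]uN ito_laguerre nuN cexpu fact_sqrt [(a`! * _)%N]mulnC.
rewrite -invr_expz -exprnP -exprVn -/e uNp -(rmorph_nat (real_complex R)).
by rewrite !realCM realCX; ring.
Qed.

End MatrixUnits.

(** * Coordinates adapted to the form, and the theorem *)

Lemma big_pairs (K : Type) (idx : K) (op : Monoid.com_law idx) n
    (F : 'I_(n.*2) -> K) :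
  \big[op/idx]_k F k = \big[op/idx]_(j < n) op (F (fst_idx j)) (F (snd_idx j)).
Proof.
elim: n F => [|n IH] F; first by rewrite !big_ord0.
rewrite [LHS](@big_ord_recl _ _ _ n.*2.+1) [X in op _ X]big_ord_recl IH.
rewrite [RHS]big_ord_recl Monoid.mulmA.
congr (op (op _ _) _); [by congr F; exact/val_inj..|].
by apply: eq_bigr => j _; congr (op _ _); congr F; exact/val_inj.
Qed.

Section AdaptedCoordinates.
Context {R : realType} {n : nat}.
Local Notation C := R[i].
Implicit Types (A V : 'M[R]_(n.*2)) (mu : 'I_n -> R) (x y : 'cV[R]_(n.*2)).

Lemma fst_snd_idx (i j : 'I_n) : fst_idx i <> snd_idx j.
Proof. by move=> /(congr1 (fun k => odd (val k))) /=; rewrite !odd_double. Qed.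

Lemma fst_idx_inj : injective (@fst_idx n).
Proof.
by move=> i j /(congr1 (fun k => (val k)./2)) /=; rewrite !doubleK => /val_inj.
Qed.

Lemma snd_idx_inj : injective (@snd_idx n).
Proof.
move=> i j /(congr1 (fun k => (val k)./2)) /=.
by rewrite !uphalf_double => /val_inj.
Qed.

Lemma bform_sum A V x y : V^T *m V = 1%:M ->
  bform A y x = \sum_k \sum_l
    (invmx V *m y) k 0 * bform A (col k V) (col l V) * (invmx V *m x) l 0.
Proof.
move=> VV; have [_ uV] := mulmx1_unit VV.
rewrite /bform -{1}[y](mulKVmx uV) -{1}[x](mulKVmx uV).
set c := invmx V *m y; set d := invmx V *m x.
have E k l : ((col k V)^T *m A *m col l V) 0 0 = (V^T *m A *m V) k l.
  rewrite [LHS]mxE [RHS]mxE; apply: eq_bigr => i _; rewrite !mxE; congr (_ * _).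
  by apply: eq_bigr => e _; rewrite !mxE.
under eq_bigr do under eq_bigr do rewrite E.
have -> : (V *m c)^T *m A *m (V *m d) = c^T *m (V^T *m A *m V) *m d.
  by rewrite trmx_mul !mulmxA.
rewrite mxE exchange_big; apply: eq_bigr => l _ /=.
by rewrite mxE mulr_suml; apply: eq_bigr => k _; rewrite mxE.
Qed.

(** In an orthonormal normalizing basis each pair contributes its own symplectic form,
    so that the oscillating factor splits over the pairs. *)
Lemma normalized_bform A V mu x y : normalizes A V mu ->
  let c := invmx V *m y in let d := invmx V *m x in
  bform A y x = \sum_j mu j *
    (c (snd_idx j) 0 * d (fst_idx j) 0 - c (fst_idx j) 0 * d (snd_idx j) 0).
Proof.
move=> h c d; rewrite (bform_sum _ _ _ (normalizes_orthonormal h)) big_pairs.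
apply: eq_bigr => j _.
rewrite (bigD1 (snd_idx j))//= big1 ?addr0 => [|l lj]; last first.
  rewrite (normalizes_other h) ?mulr0 ?mul0r// => i; split.
    move=> e; have /= /fst_idx_inj ij := congr1 fst e.
    by have /= el := congr1 snd e; rewrite el ij eqxx in lj.
  by move=> /(congr1 fst)/= /fst_snd_idx.
rewrite (bigD1 (fst_idx j))//= big1 ?addr0 => [|l lj]; last first.
  rewrite (normalizes_other h) ?mulr0 ?mul0r// => i; split.
    by move=> /(congr1 fst)/= /esym/fst_snd_idx.
  move=> e; have /= /snd_idx_inj ij := congr1 fst e.
  by have /= el := congr1 snd e; rewrite el ij eqxx in lj.
rewrite (normalizes_snd_fst h) -[bform _ _ _]opprK (normalizes_fst_snd h).
by rewrite -/c -/d; ring.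
Qed.

Definition pair_idx (k : 'I_(n.*2)) : 'I_n :=
  Ordinal (etrans (esym (ltn_double (val k)./2 n))
    (leq_ltn_trans (leq_trans (leq_addl (odd k) _) (eq_leq (odd_double_half k)))
       (ltn_ord k))).

Lemma pair_idx_fst j : pair_idx (fst_idx j) = j.
Proof. by apply/val_inj; rewrite /= doubleK. Qed.

Lemma pair_idx_snd j : pair_idx (snd_idx j) = j.
Proof. by apply/val_inj; rewrite /= uphalf_double. Qed.

(** The change of variables after which the entries come in pairs that are the
    coordinates [coord_pair] scaled by s. *)
Definition adapted_mx V (s : 'I_n -> R) : 'M[R]_(n.*2) :=
  V *m diag_mx (\row_k (s (pair_idx k))^-1).

Lemma norm_det_adapted_mx V (s : 'I_n -> R) :
  V^T *m V = 1%:M -> (forall j, 0 < s j) ->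
  `|\det (adapted_mx V s)| = \prod_j (s j ^+ 2)^-1.
Proof.
move=> VV s0; rewrite det_mulmx det_diag normrM.
have -> : `|\det V| = 1.
  have : `|\det V| ^+ 2 = 1.
    by rewrite -normrX expr2 -{1}det_tr -det_mulmx VV det1 normr1.
  by move/eqP; rewrite sqrp_eq1// => /eqP.
rewrite mul1r big_pairs ger0_norm; last first.
  by apply: prodr_ge0 => j _; rewrite !mxE mulr_ge0// invr_ge0 ltW.
by apply: eq_bigr => j _; rewrite !mxE pair_idx_fst pair_idx_snd /= -invfM.
Qed.

Lemma adapted_mx_unit V (s : 'I_n -> R) :
  V^T *m V = 1%:M -> (forall j, 0 < s j) -> adapted_mx V s \in unitmx.
Proof.
move=> VV s0; rewrite unitmxE unitfE -normr_eq0 norm_det_adapted_mx//.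
by apply/prodf_neq0 => j _; rewrite invr_eq0 expf_neq0// gt_eqF.
Qed.

Lemma coord_pair_adapted V (s : 'I_n -> R) (t : (n.*2).-tuple (measurableTypeR R)) j :
  V^T *m V = 1%:M -> (forall j, 0 < s j) ->
  (s j)%:C * coord_pair V (\col_k tnth (mxaff (adapted_mx V s) 0 t) k) j =
  plane_point (tnth t (fst_idx j), tnth t (snd_idx j)) :> C.
Proof.
move=> VV s0; have [_ uV] := mulmx1_unit VV.
have -> : (\col_k tnth (mxaff (adapted_mx V s) 0 t) k : 'cV[R]_(n.*2)) =
    V *m (diag_mx (\row_k (s (pair_idx k))^-1) *m \col_k tnth t k).
  apply/matrixP => k i; rewrite ord1 mxE tnth_mktuple addr0 /adapted_mx.
  by rewrite mulmxA.
rewrite /coord_pair mulKmx// mul_diag_mx !mxE pair_idx_fst pair_idx_snd.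
have sj : s j != 0 by rewrite gt_eqF.
apply/eqP; rewrite eq_complex /=; apply/andP; split; apply/eqP.
  by rewrite mul0r subr0 mulVKf.
by rewrite mul0r addr0 mulVKf.
Qed.

End AdaptedCoordinates.

Lemma cintegral_unitmx (R : realType) d (A : 'M[R]_d) (f : 'cV[R]_d -> R[i]) I :
  A \in unitmx ->
  has_cint (lebesgue_tuple d) (fun t => f (\col_k tnth (mxaff A 0 t) k)) I ->
  cintegral f = `|\det A|%:C * I.
Proof.
move=> uA hf.
exact: has_cint_Rintegral (has_cint_unitmx (F := fun t => f (\col_k tnth t k)) uA hf).
Qed.

Section UnitDirection.
Context {R : realType} {r n : nat}.
Implicit Types (B : 'I_r -> 'M[R]_(n.*2)) (tau : 'cV[R]_r).

Lemma enorm_gt0 tau : tau != 0 -> 0 < enorm tau.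
Proof.
move=> t0; rewrite sqrtr_gt0 lt_neqAle eq_sym sumr_ge0 => [|k _]; last exact: sqr_ge0.
rewrite andbT; apply: contraNneq t0 => /eqP.
rewrite psumr_eq0 => [|k _]; last exact: sqr_ge0.
move=> /allP h; apply/eqP/matrixP => i j; rewrite ord1 mxE.
by apply/eqP; rewrite -sqrf_eq0; apply: h; rewrite mem_index_enum.
Qed.

Lemma pencil_udir B tau : tau != 0 ->
  pencil B tau = enorm tau *: pencil B (udir tau).
Proof.
move=> /enorm_gt0 t0; rewrite /pencil scaler_sumr; apply: eq_bigr => b _.
by rewrite /udir mxE scalerA mulrA mulfV ?gt_eqF// mul1r.
Qed.

Lemma udir_neq0 tau : tau != 0 -> udir tau != 0.
Proof. by move=> t0; rewrite scaler_eq0 invr_eq0 gt_eqF ?enorm_gt0. Qed.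

Lemma pencil_udir_unit B tau : tau != 0 -> pencil B tau \in unitmx ->
  pencil B (udir tau) \in unitmx.
Proof.
move=> t0; rewrite (pencil_udir B t0) => h.
have t1 : enorm tau != 0 by rewrite gt_eqF ?enorm_gt0.
by move: h; rewrite !unitmxE detZ unitrM => /andP[].
Qed.

End UnitDirection.

Theorem proposition1p2 (R : realType) (n r : nat) (hn : (0 < n)%N)
    (hr : (0 < r)%N) (B : 'I_r -> 'M[R]_(n.*2))
    (hB : forall b, (B b)^T = - B b)
    (v : 'cV[R]_r -> 'M[R]_(n.*2)) (mu : 'cV[R]_r -> 'I_n -> R)
    (hv : normalizing_choice B v mu)
    (tau : 'cV[R]_r) (htau : tau != 0) (hnd : pencil B tau \in unitmx)
    (k p q m : {ffun 'I_n -> nat})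
    (hk : forall j, (0 < k j)%N) (hp : forall j, (0 < p j)%N)
    (hq : forall j, (0 < q j)%N) (hm : forall j, (0 < m j)%N) :
  twisted_conv B tau
    (fun y => exp_laguerre v mu (fun j => (minn (k j) (p j)).-1)
                (fun j => (p j)%:Z - (k j)%:Z) y tau)
    (fun y => exp_laguerre v mu (fun j => (minn (q j) (m j)).-1)
                (fun j => (q j)%:Z - (m j)%:Z) y tau) =
  (fun y => (k == q)%:R *
     exp_laguerre v mu (fun j => (minn (p j) (m j)).-1)
       (fun j => (p j)%:Z - (m j)%:Z) y tau).
Proof.
have [hV vE] := hv tau htau hnd.
have [hV1 _] := hv (udir tau) (udir_neq0 htau) (pencil_udir_unit htau hnd).
rewrite -vE in hV1; set V := v tau in hV hV1 *.
have T0 := enorm_gt0 htau; set T := enorm tau in T0 *.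
pose md j := mu (udir tau) j; have md0 j : 0 < md j := normalizes_pos hV1 j.
have VV := normalizes_orthonormal hV1.
(* At this scale the Gaussian exponents become - |u|^2 / 2. *)
pose s j := Num.sqrt (2 * T) * Num.sqrt (md j).
have s0 j : 0 < s j by rewrite mulr_gt0 ?sqrtr_gt0// mulr_gt0.
have s2 j : s j ^+ 2 = 2 * T * md j.
  by rewrite exprMn !sqr_sqrtr// ltW// mulr_gt0.
pose u (y : 'cV[R]_(n.*2)) j : R[i] := (s j)%:C * coord_pair V y j.
pose c j : R[i] := (md j)%:C * (2 * T / pi)%:C.
have expE (a b : {ffun 'I_n -> nat}) (ha : forall j, (0 < a j)%N)
    (hb : forall j, (0 < b j)%N) y :
    exp_laguerre v mu (fun j => (minn (a j) (b j)).-1)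
      (fun j => (a j)%:Z - (b j)%:Z) y tau =
    \prod_j (c j * hermite_fun (a j).-1 (b j).-1 (u y j)).
  apply: eq_bigr => j _; rewrite -mulrA.
  have -> : (minn (a j) (b j)).-1 = minn (a j).-1 (b j).-1.
    by case: (a j) (b j) (ha j) (hb j) => [|a'] [|b'] //; rewrite minnSS.
  have -> : (a j)%:Z - (b j)%:Z = (a j).-1%:Z - (b j).-1%:Z.
    case: (a j) (b j) (ha j) (hb j) => [|a'] [|b'] // _ _ /=.
    by rewrite -addn1 -[b'.+1]addn1 !PoszD opprD addrACA subrr addr0.
  rewrite exp_laguerre1E -/T -/V; congr (_ * (_ * hermite_fun _ _ _)).
  by rewrite /u /s realCM mulrA.
have muE j : mu tau j = T * md j.
  rewrite -(normalizes_snd_fst hV) /md -(normalizes_snd_fst hV1) (pencil_udir B htau).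
  by rewrite /bform -scalemxAr -scalemxAl mxE.
apply/funext => y.
pose H j (z : measurableTypeR R * measurableTypeR R) : R[i] :=
  c j ^+ 2 * (expi (complex.Im ((u y j)^* * plane_point z)) *
    hermite_fun (p j).-1 (k j).-1 (u y j - plane_point z) *
    hermite_fun (q j).-1 (m j).-1 (plane_point z)).
have hH j := has_cintZ (c j ^+ 2) (has_cint_hermite_fun (u y j)
  (p j).-1 (k j).-1 (q j).-1 (m j).-1).
have hI := has_cint_prod_pairs (H := H) hH.
have minkp : (fun j => (minn (k j) (p j)).-1) = (fun j => (minn (p j) (k j)).-1).
  by apply/funext => j; rewrite minnC.
rewrite /twisted_conv (cintegral_unitmx (adapted_mx_unit VV s0) (has_cint_ext _ hI)).
  rewrite (norm_det_adapted_mx VV s0) rmorph_prod -big_split /= expE//.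
  (* The Jacobian, the constants c j of the two factors and the mass pi combine into
     the single constant of the result. *)
  have cE j : ((s j ^+ 2)^-1)%:C * c j ^+ 2 * pi%:C = c j.
    have p0 : pi != 0 :> R by rewrite gt_eqF ?pi_gt0.
    rewrite /c -!realCM -realCX -!realCM s2; congr (_%:C).
    by move: (pi : R) p0 => P P0; field; rewrite P0 !gt_eqF.
  have -> : (k == q)%:R = \prod_j ((k j).-1 == (q j).-1)%:R :> R[i].
    have [->|kq] := eqVneq k q; first by rewrite big1// => j _; rewrite eqxx.
    have [j kqj] : exists j, k j != q j.
      apply/existsP; rewrite -negb_forall; apply: contraNN kq => /forallP kq.
      by apply/eqP/ffunP => j; exact/eqP.
    rewrite (bigD1 j)//= (_ : _ == _ = false) ?mul0r//; apply/negbTE.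
    by apply: contraNN kqj => /eqP kqj; rewrite -(prednK (hk j)) kqj prednK.
  by rewrite -big_split; apply: eq_bigr => j _ /=; rewrite -[in RHS]cE; ring.
move=> t; set x := \col_k _.
have ux j : u x j = plane_point (tnth t (fst_idx j), tnth t (snd_idx j)).
  exact: coord_pair_adapted.
have uB j : u (y - x) j = u y j - u x j.
  rewrite /u /coord_pair mulmxBr !mxE; apply/eqP; rewrite eq_complex /=.
  by apply/andP; split; apply/eqP; ring.
have [e phase HE] : exists2 e : 'I_n -> R[i],
    expi (- 2 * bform (pencil B tau) y x) = \prod_j e j &
    forall j, H j (tnth t (fst_idx j), tnth t (snd_idx j)) = c j ^+ 2 *
      (e j * hermite_fun (p j).-1 (k j).-1 (u y j - u x j) *
       hermite_fun (q j).-1 (m j).-1 (u x j)).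
  exists (fun j => expi (complex.Im ((u y j)^* * u x j))); last first.
    by move=> j; rewrite /H -ux.
  rewrite (normalized_bform _ _ hV) mulr_sumr.
  rewrite (big_morph _ (@expiD R) (_ : expi 0 = 1)); last first.
    by rewrite /expi cos0 sin0.
  apply: eq_bigr => j _; congr expi; rewrite muE /u /coord_pair.
  set c1 := (invmx V *m y) _ 0; set c2 := (invmx V *m y) _ 0.
  set d1 := (invmx V *m x) _ 0; set d2 := (invmx V *m x) _ 0.
  transitivity (s j ^+ 2 * (c2 * d2 - c1 * d1)).
    by rewrite s2; ring.
  by rewrite /=; ring.
rewrite phase minkp !expE// -!big_split; apply: eq_bigr => j _ /=.
by rewrite uB HE; ring.
Qed.
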